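(* Assume the van Kampen setup below, with compatible future retracts $Q_k:\vec\pi_1(X_k)\to\vec\pi_1(X_k,B_k)$ and compatible future retracts $P_k:\vec\pi_1(X_k,B_k)\to\vec\pi_1(X_k,A_k)$ ($k=0,1,2$). Then there is a unique functor $P:\vec\pi_1(X,B)\to\vec\pi_1(X,A)$ with $P\circ j_k=j'_k\circ P_k$ for $k=1,2$, and the commutative cube formed by the square $(i_1,i_2,j_1,j_2)$ of the categories $\vec\pi_1(X_k,B_k)$, $\vec\pi_1(X,B)$, the square $(i'_1,i'_2,j'_1,j'_2)$ of the categories $\vec\pi_1(X_k,A_k)$, $\vec\pi_1(X,A)$, and the functors $P_0,P_1,P_2,P$, is a pushout in the arrow category of $\mathbf{Cat}$ (i.e. $P$ is the pushout of $P_1$ and $P_2$ over $P_0$).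
   Context: A d-space is a topological space with a set of continuous paths $[0,1]\to X$ (dipaths) containing all constant paths, closed under precomposition with continuous non-decreasing maps $[0,1]\to[0,1]$ and under concatenation; subsets carry the dipaths with image in them. The fundamental category $\vec\pi_1(X)$ has objects the points of $X$ and morphisms $a\to b$ the classes of dipaths from $a$ to $b$ modulo the equivalence relation generated by endpoint-fixing directed homotopies; composition is concatenation. For $A\subseteq X$, $\vec\pi_1(X,A)$ is the full subcategory on objects in $A$. For $A\subseteq B\subseteq X$ with inclusion $\iota:\vec\pi_1(X,A)\to\vec\pi_1(X,B)$, a future retract is a functor $P:\vec\pi_1(X,B)\to\vec\pi_1(X,A)$ left adjoint to $\iota$ whose unit satisfies $\eta_a=\mathrm{id}_a$ for $a\in A$. Van Kampen setup: $X$ a d-space, $X_1,X_2\subseteq X$ with $X=\mathrm{Int}(X_1)\cup\mathrm{Int}(X_2)$, dipaths of $X$ the finite concatenations of dipaths of $X_1$ and $X_2$, $X_0=X_1\cap X_2$. For $k=0,1,2$, $A_k\subseteq B_k\subseteq X_k$ with $A_0=A_1\cap A_2$, $B_0=B_1\cap B_2$, $A=A_1\cup A_2$, $B=B_1\cup B_2$, $A=\mathrm{Int}_A(A_1)\cup\mathrm{Int}_A(A_2)$, $B=\mathrm{Int}_B(B_1)\cup\mathrm{Int}_B(B_2)$. Inclusion-induced functors: $i_k:\vec\pi_1(X_0,B_0)\to\vec\pi_1(X_k,B_k)$, $j_k:\vec\pi_1(X_k,B_k)\to\vec\pi_1(X,B)$, $i'_k:\vec\pi_1(X_0,A_0)\to\vec\pi_1(X_k,A_k)$,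 $j'_k:\vec\pi_1(X_k,A_k)\to\vec\pi_1(X,A)$ ($k=1,2$). Compatible future retracts $Q_k:\vec\pi_1(X_k)\to\vec\pi_1(X_k,B_k)$: each a future retract with unit $\theta^k$, commuting with the inclusion-induced functors from index $0$ to $k=1,2$, with $\theta^0_x$ mapping to $\theta^k_x$ for $x\in X_0$. Compatible future retracts $P_k:\vec\pi_1(X_k,B_k)\to\vec\pi_1(X_k,A_k)$: each a future retract with unit $\eta^k$, $P_k\circ i_k=i'_k\circ P_0$ ($k=1,2$), and $\eta^0_x$ mapping to $\eta^k_x$ for $x\in B_0$. *)

(* Defs.v *)
From HB Require Import structures.
From mathcomp Require Import all_boot all_order all_algebra.
From mathcomp Require Import all_classical all_reals topology normedtype.
From mathcomp Require Import lra.
From Stdlib Require Import Relations ClassicalEpsilon.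

Set Implicit Arguments.
Unset Strict Implicit.
Unset Printing Implicit Defensive.
Import Order.TTheory GRing.Theory Num.Theory numFieldNormedType.Exports.
Local Open Scope classical_set_scope.
Local Open Scope ring_scope.

Record precat := PreCat {
  ob : Type;
  hom : ob -> ob -> Type;
  idm : forall a, hom a a;
  comp : forall a b c, hom a b -> hom b c -> hom a c }.
Arguments hom : clear implicits.
Arguments idm {p} a.
Arguments comp {p a b c}.

Definition is_category (C : precat) : Prop :=
  (forall a b (f : hom C a b), comp (idm a) f = f) /\
  (forall a b (f : hom C a b), comp f (idm b) = f) /\
  (forall a b c d (f : hom C a b) (g : hom C b c) (h : hom C c d),
      comp (comp f g) h = comp f (comp g h)).

Record functor (C D : precat) := Functor {
  fobj : ob C -> ob D;
  fmap : forall a b, hom C a b -> hom D (fobj a) (fobj b) }.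
Arguments fobj {C D}.
Arguments fmap {C D} f {a b}.

Definition is_functor (C D : precat) (F : functor C D) : Prop :=
  (forall a, fmap F (idm a) = idm (fobj F a)) /\
  (forall a b c (f : hom C a b) (g : hom C b c),
      fmap F (comp f g) = comp (fmap F f) (fmap F g)).

Definition fcomp (C D E : precat) (F : functor C D) (G : functor D E) :
  functor C E :=
  @Functor C E (fun x => fobj G (fobj F x)) (fun a b f => fmap G (fmap F f)).

(* P : C -> S is a future retract for the inclusion iota : S -> C with unit
   eta: P is left adjoint to iota with unit eta (natural, universal), and
   eta_a = id_a for a in S. *)
Definition is_future_retract (C S : precat) (iota : functor S C)
    (P : functor C S) (eta : forall b : ob C, hom C b (fobj iota (fobj P b))) :
    Prop :=
  is_functor P /\
  (forall b b' (f : hom C b b'),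
      comp f (eta b') = comp (eta b) (fmap iota (fmap P f))) /\
  (forall (b : ob C) (a : ob S) (f : hom C b (fobj iota a)),
      exists! g : hom S (fobj P b) a, comp (eta b) (fmap iota g) = f) /\
  (forall a : ob S,
      existT (fun y => hom C (fobj iota a) y) _ (eta (fobj iota a))
      = existT (fun y => hom C (fobj iota a) y) _ (idm (fobj iota a))).
Arguments is_future_retract {C S} iota P eta.

Definition arrow_pushout (C0 C1 C2 C3 D0 D1 D2 D3 : precat)
  (F0 : functor C0 D0) (F1 : functor C1 D1) (F2 : functor C2 D2)
  (F3 : functor C3 D3)
  (i1 : functor C0 C1) (i2 : functor C0 C2) (j1 : functor C1 C3)
  (j2 : functor C2 C3)
  (i1' : functor D0 D1) (i2' : functor D0 D2) (j1' : functor D1 D3)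
  (j2' : functor D2 D3) : Prop :=
  fcomp i1 j1 = fcomp i2 j2 /\ fcomp i1' j1' = fcomp i2' j2' /\
  fcomp i1 F1 = fcomp F0 i1' /\ fcomp i2 F2 = fcomp F0 i2' /\
  fcomp j1 F3 = fcomp F1 j1' /\ fcomp j2 F3 = fcomp F2 j2' /\
  forall (E E' : precat) (G : functor E E')
         (u1 : functor C1 E) (u2 : functor C2 E)
         (u1' : functor D1 E') (u2' : functor D2 E'),
    is_category E -> is_category E' -> is_functor G ->
    is_functor u1 -> is_functor u2 -> is_functor u1' -> is_functor u2' ->
    fcomp u1 G = fcomp F1 u1' -> fcomp u2 G = fcomp F2 u2' ->
    fcomp i1 u1 = fcomp i2 u2 -> fcomp i1' u1' = fcomp i2' u2' ->
    exists! vv : functor C3 E * functor D3 E',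
      [/\ is_functor vv.1, is_functor vv.2, fcomp vv.1 G = fcomp F3 vv.2,
          fcomp j1 vv.1 = u1 /\ fcomp j2 vv.1 = u2 &
          fcomp j1' vv.2 = u1' /\ fcomp j2' vv.2 = u2'].

Section DSpace.
Variable R : realType.

Definition uI : set R := [set t | 0 <= t <= 1].

Definition is_reparam (phi : R -> R) : Prop :=
  (forall t, uI t -> uI (phi t)) /\ {within uI, continuous phi} /\
  (forall s t, uI s -> uI t -> s <= t -> phi s <= phi t).

(* concatenation of paths (paths are functions R -> X, only their values on
   [0,1] matter) *)
Definition concat (X : Type) (p q : R -> X) : R -> X :=
  fun t => if t <= 2^-1 then p (2 * t) else q (2 * t - 1).

Record dspace (X : topologicalType) := DSpace {
  dipath : (R -> X) -> Prop;
  dipath_cont : forall p, dipath p -> {within uI, continuous p};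
  dipath_const : forall (x : X) p, (forall t, uI t -> p t = x) -> dipath p;
  dipath_reparam : forall p phi q, dipath p -> is_reparam phi ->
      (forall t, uI t -> q t = p (phi t)) -> dipath q;
  dipath_concat : forall p q r, dipath p -> dipath q -> p 1 = q 0 ->
      (forall t, uI t -> r t = concat p q t) -> dipath r }.

Variables (X : topologicalType) (d : dspace X).

Definition dipath_in (Y : set X) (p : R -> X) : Prop :=
  dipath d p /\ forall t, uI t -> Y (p t).

Definition unit_square : set (R * R) := [set z | uI z.1 /\ uI z.2].

(* endpoint-fixing directed homotopy in Y from p to q (paths from a to b):
   a d-map H : ↑I x ↑I -> Y *)
Definition dihomotopy (Y : set X) (a b : X) (p q : R -> X) : Prop :=
  exists H : R -> R -> X,
    {within unit_square, continuous (fun z : R * R => H z.1 z.2)} /\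
    (forall s, uI s -> H s 0 = p s /\ H s 1 = q s) /\
    (forall t, uI t -> H 0 t = a /\ H 1 t = b) /\
    (forall al be, is_reparam al -> is_reparam be ->
        dipath_in Y (fun u => H (al u) (be u))).

Definition dhequiv (Y : set X) (a b : X) : relation (R -> X) :=
  clos_refl_sym_trans _ (dihomotopy Y a b).

Definition dclass (Y : set X) (a b : X) (p : R -> X) : set (R -> X) :=
  [set q | dhequiv Y a b p q].

Definition is_dipath_from (Y : set X) (a b : X) (p : R -> X) : Prop :=
  dipath_in Y p /\ p 0 = a /\ p 1 = b.

Definition pihom (Y : set X) (a b : X) : Type :=
  {C : set (R -> X) | exists p, is_dipath_from Y a b p /\ C = dclass Y a b p}.

Definition rep (Y : set X) (a b : X) (C : pihom Y a b) : R -> X :=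
  proj1_sig (constructive_indefinite_description _ (proj2_sig C)).

Lemma rep_spec (Y : set X) (a b : X) (C : pihom Y a b) :
  is_dipath_from Y a b (rep C).
Proof.
rewrite /rep; case: (constructive_indefinite_description _ _) => p [Hp _] /=.
exact: Hp.
Qed.

Lemma const_spec (Y : set X) (a : X) : Y a ->
  is_dipath_from Y a a (fun _ => a).
Proof.
move=> Ya; split; last by [].
by split=> //; apply: (@dipath_const _ d a).
Qed.

Lemma concat_spec (Y : set X) (a b c : X) (p q : R -> X) :
  is_dipath_from Y a b p -> is_dipath_from Y b c q ->
  is_dipath_from Y a c (concat p q).
Proof.
move=> [[dp Yp] [p0 p1]] [[dq Yq] [q0 q1]].
split; [split|split].
- by apply: (dipath_concat dp dq) => //; rewrite p1 q0.
- move=> t /andP [t0 t1]; rewrite /concat.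
  case: ifP => ht.
  + by apply: Yp; apply/andP; split; lra.
  + have ht' : 2^-1 < t by rewrite ltNge ht.
    by apply: Yq; apply/andP; split; lra.
- by rewrite /concat ifT ?mulr0 // invr_ge0 ler0n.
- rewrite /concat ifF; first by rewrite mulr1 -[X in q (X - _)]/(1 + 1) addrK.
  by apply/negbTE; rewrite -ltNge invf_lt1 ?ltr1n ?ltr0n.
Qed.

Definition pi_id (Y : set X) (a : X) (Ya : Y a) : pihom Y a a :=
  exist _ (dclass Y a a (fun _ => a))
        (ex_intro _ (fun _ => a) (conj (const_spec Ya) erefl)).

Definition pi_comp (Y : set X) (a b c : X) (f : pihom Y a b)
    (g : pihom Y b c) : pihom Y a c :=
  exist _ (dclass Y a c (concat (rep f) (rep g)))
    (ex_intro _ (concat (rep f) (rep g))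
       (conj (concat_spec (rep_spec f) (rep_spec g)) erefl)).

Definition pi1 (Y Z : set X) (hZY : Z `<=` Y) : precat :=
  @PreCat {x : X | Z x} (fun a b => pihom Y (proj1_sig a) (proj1_sig b))
    (fun a => pi_id (hZY _ (proj2_sig a)))
    (fun a b c f g => pi_comp f g).

Lemma dipath_from_sub (Y1 Y2 : set X) (a b : X) (p : R -> X) :
  Y1 `<=` Y2 -> is_dipath_from Y1 a b p -> is_dipath_from Y2 a b p.
Proof. by move=> h [[dp Yp] e]; split=> //; split=> // t /Yp /h. Qed.

Definition incl (Y1 Z1 Y2 Z2 : set X) (h1 : Z1 `<=` Y1) (h2 : Z2 `<=` Y2)
    (hY : Y1 `<=` Y2) (hZ : Z1 `<=` Z2) : functor (pi1 h1) (pi1 h2) :=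
  @Functor (pi1 h1) (pi1 h2)
    (fun x => exist _ (proj1_sig x) (hZ _ (proj2_sig x)))
    (fun a b f => exist _ (dclass Y2 (proj1_sig a) (proj1_sig b) (rep f))
       (ex_intro _ (rep f) (conj (dipath_from_sub hY (rep_spec f)) erefl))).

Definition rel_interior (S T : set X) : set X :=
  [set x | S x /\ exists U, open U /\ U x /\ U `&` S `<=` T].

End DSpace.

Record vk_data (X : topologicalType) := VKData {
  X1 : set X; X2 : set X; A1 : set X; A2 : set X; B1 : set X; B2 : set X;
  hA1B1 : A1 `<=` B1; hA2B2 : A2 `<=` B2;
  hB1X1 : B1 `<=` X1; hB2X2 : B2 `<=` X2 }.

Section VK.
Variables (R : realType) (X : topologicalType) (d : dspace R X)
          (V : vk_data X).

Definition X0 := X1 V `&` X2 V.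
Definition A0 := A1 V `&` A2 V.
Definition B0 := B1 V `&` B2 V.
Definition AU := A1 V `|` A2 V.
Definition BU := B1 V `|` B2 V.

Lemma hB0X0 : B0 `<=` X0. Proof. by move=> x [/(@hB1X1 _ V) h1 /(@hB2X2 _ V) h2]. Qed.
Lemma hA0B0 : A0 `<=` B0. Proof. by move=> x [/(@hA1B1 _ V) h1 /(@hA2B2 _ V) h2]. Qed.
Lemma hA0X0 : A0 `<=` X0. Proof. by move=> x /hA0B0 /hB0X0. Qed.
Lemma hA1X1 : A1 V `<=` X1 V. Proof. by move=> x /(@hA1B1 _ V) /(@hB1X1 _ V). Qed.
Lemma hA2X2 : A2 V `<=` X2 V. Proof. by move=> x /(@hA2B2 _ V) /(@hB2X2 _ V). Qed.
Lemma hAUBU : AU `<=` BU.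
Proof. by move=> x [/(@hA1B1 _ V) h|/(@hA2B2 _ V) h]; [left|right]. Qed.

Definition cX0 := pi1 d (@subset_refl _ X0).
Definition cX1 := pi1 d (@subset_refl _ (X1 V)).
Definition cX2 := pi1 d (@subset_refl _ (X2 V)).
Definition cB0 := pi1 d hB0X0.
Definition cB1 := pi1 d (@hB1X1 _ V).
Definition cB2 := pi1 d (@hB2X2 _ V).
Definition cBX := pi1 d (@subsetT _ BU).
Definition cA0 := pi1 d hA0X0.
Definition cA1 := pi1 d hA1X1.
Definition cA2 := pi1 d hA2X2.
Definition cAX := pi1 d (@subsetT _ AU).

Definition eX1 : functor cX0 cX1 := incl d _ _ (@subIsetl _ _ _) (@subIsetl _ _ _).
Definition eX2 : functor cX0 cX2 := incl d _ _ (@subIsetr _ _ _) (@subIsetr _ _ _).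
Definition i1 : functor cB0 cB1 := incl d _ _ (@subIsetl _ _ _) (@subIsetl _ _ _).
Definition i2 : functor cB0 cB2 := incl d _ _ (@subIsetr _ _ _) (@subIsetr _ _ _).
Definition j1 : functor cB1 cBX := incl d _ _ (@subsetT _ _) (@subsetUl _ _ _).
Definition j2 : functor cB2 cBX := incl d _ _ (@subsetT _ _) (@subsetUr _ _ _).
Definition i1' : functor cA0 cA1 := incl d _ _ (@subIsetl _ _ _) (@subIsetl _ _ _).
Definition i2' : functor cA0 cA2 := incl d _ _ (@subIsetr _ _ _) (@subIsetr _ _ _).
Definition j1' : functor cA1 cAX := incl d _ _ (@subsetT _ _) (@subsetUl _ _ _).
Definition j2' : functor cA2 cAX := incl d _ _ (@subsetT _ _) (@subsetUr _ _ _).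
Definition kB0 : functor cB0 cX0 := incl d _ _ (@subset_refl _ _) hB0X0.
Definition kB1 : functor cB1 cX1 := incl d _ _ (@subset_refl _ _) (@hB1X1 _ V).
Definition kB2 : functor cB2 cX2 := incl d _ _ (@subset_refl _ _) (@hB2X2 _ V).
Definition kA0 : functor cA0 cB0 := incl d _ _ (@subset_refl _ _) hA0B0.
Definition kA1 : functor cA1 cB1 := incl d _ _ (@subset_refl _ _) (@hA1B1 _ V).
Definition kA2 : functor cA2 cB2 := incl d _ _ (@subset_refl _ _) (@hA2B2 _ V).

Definition vk_hyps : Prop :=
  [set: X] = interior (X1 V) `|` interior (X2 V) /\
  (* dipaths of X are finite concatenations of dipaths of X1 and X2 *)
  (forall p, dipath d p ->
     exists (n : nat) (t : nat -> R),
       t 0%N = 0 /\ t n = 1 /\ (forall i, (i < n)%N -> t i < t i.+1) /\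
       forall i, (i < n)%N ->
         (forall s, t i <= s <= t i.+1 -> X1 V (p s)) \/
         (forall s, t i <= s <= t i.+1 -> X2 V (p s))) /\
  AU = rel_interior AU (A1 V) `|` rel_interior AU (A2 V) /\
  BU = rel_interior BU (B1 V) `|` rel_interior BU (B2 V).

Definition compatible_Q (Q0 : functor cX0 cB0) (Q1 : functor cX1 cB1)
  (Q2 : functor cX2 cB2)
  (th0 : forall x : ob cX0, hom cX0 x (fobj kB0 (fobj Q0 x)))
  (th1 : forall x : ob cX1, hom cX1 x (fobj kB1 (fobj Q1 x)))
  (th2 : forall x : ob cX2, hom cX2 x (fobj kB2 (fobj Q2 x))) : Prop :=
  is_future_retract kB0 Q0 th0 /\ is_future_retract kB1 Q1 th1 /\
  is_future_retract kB2 Q2 th2 /\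
  fcomp eX1 Q1 = fcomp Q0 i1 /\ fcomp eX2 Q2 = fcomp Q0 i2 /\
  (forall x : ob cX0,
     existT (fun y => hom cX1 (fobj eX1 x) y) _ (fmap eX1 (th0 x))
     = existT (fun y => hom cX1 (fobj eX1 x) y) _ (th1 (fobj eX1 x))) /\
  (forall x : ob cX0,
     existT (fun y => hom cX2 (fobj eX2 x) y) _ (fmap eX2 (th0 x))
     = existT (fun y => hom cX2 (fobj eX2 x) y) _ (th2 (fobj eX2 x))).

Definition compatible_P (P0 : functor cB0 cA0) (P1 : functor cB1 cA1)
  (P2 : functor cB2 cA2)
  (et0 : forall x : ob cB0, hom cB0 x (fobj kA0 (fobj P0 x)))
  (et1 : forall x : ob cB1, hom cB1 x (fobj kA1 (fobj P1 x)))
  (et2 : forall x : ob cB2, hom cB2 x (fobj kA2 (fobj P2 x))) : Prop :=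
  is_future_retract kA0 P0 et0 /\ is_future_retract kA1 P1 et1 /\
  is_future_retract kA2 P2 et2 /\
  fcomp i1 P1 = fcomp P0 i1' /\ fcomp i2 P2 = fcomp P0 i2' /\
  (forall x : ob cB0,
     existT (fun y => hom cB1 (fobj i1 x) y) _ (fmap i1 (et0 x))
     = existT (fun y => hom cB1 (fobj i1 x) y) _ (et1 (fobj i1 x))) /\
  (forall x : ob cB0,
     existT (fun y => hom cB2 (fobj i2 x) y) _ (fmap i2 (et0 x))
     = existT (fun y => hom cB2 (fobj i2 x) y) _ (et2 (fobj i2 x))).

End VK.

(* Main.v *)
Require Import Defs.
From mathcomp Require Import all_boot all_classical all_reals topology normedtype.
From mathcomp Require Import all_order all_algebra ring lra.
From mathcomp Require interval_inference.
From Stdlib Require Import Relations Eqdep.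

(** The pushout in the arrow category is computed levelwise, so it suffices that
    the square of the [pi1 X_k Z_k] is a pushout of categories for [Z = B] and
    for [Z = A], where the retractions onto [A_k] are the composites of the
    [Q_k] and the [P_k].

    Existence.  Composing functors [w_k] on [pi1 X_k Z_k] with the retractions
    gives compatible functors on the [pi1 X_k], so one needs van Kampen for
    [Z = X].  A dipath [p] is transported along a subdivision into pieces lying
    in [X_1] or [X_2]: the value [psi t] of the initial segment [p|[0,t]] is
    characterised by [psi t = psi s . u_k (p|[s,t])] whenever [p] maps [[s,t]]
    to [X_k].  For homotopy invariance the square is cut by a Lebesgue number
    argument into small squares lying in some [X_k]; in each of them
    bottom-then-right and left-then-top are both dihomotopic to their pointwise
    minimum.

    Uniqueness.  A dipath between points of [Z] is a product of pieces [g_i]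
    between arbitrary points; naturality of the units rewrites it as the product
    of the [Q_k g_i], whose endpoints lie in [Z]. *)

Set Implicit Arguments.
Unset Strict Implicit.
Unset Printing Implicit Defensive.
(* MathComp shadows [hom] and [comp]. *)
Import Defs.
Import Order.TTheory GRing.Theory Num.Theory numFieldNormedType.Exports.
Local Open Scope classical_set_scope.
Local Open Scope ring_scope.

(** * Continuity on the unit interval and the unit square *)

Section Continuity.

(** The pieces of a subdivided dipath start and end anywhere in [X], so a functor on [pi1 X_k Z_k]
    has no value on them. The retractions supply one, and as their units are identities on [Z_k],
    values that already existed are kept. Agreement of the units on the overlap allows consecutive
    pieces to lie in different [X_k].

    Directedness shapes the homotopies: the straight line between two monotone maps is monotone in
    its own parameter only if one map lies below the other. Incomparable monotone paths in the
    square are therefore linked through their minimum, by a zigzag of two dihomotopies. Cells of a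
    dihomotopy admit this because it is directed in both variables, so that all four sides of a cell
    are dipaths.

    The rule defining a transported value is imposed on all segments lying in some [X_k], not on
    those of one chosen subdivision; two transports can then be compared along any subdivision, and
    no common refinements are needed. *)

Lemma within_retract (T U : topologicalType) (A : set T) (r : T -> T)
    (f : T -> U) :
  continuous r -> (forall x, A (r x)) -> {within A, continuous f} ->
  continuous (fun x => f (r x)).
Proof.
move=> cr Ar /subspace_continuousP cf x B /(cf _ (Ar x)) /cr.
by rewrite /nbhs /= => h; apply: filterS h => y; apply.
Qed.

Lemma within_continuous_eq (T U : topologicalType) (A : set T)
    (f g : T -> U) :
  continuous g -> (forall x, A x -> f x = g x) -> {within A, continuous f}.
Proof.
move=> cg fg; apply/subspace_continuousP => x Ax B.
change (nbhs (f x) B -> within A (nbhs x) (f @^-1` B)).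
rewrite (fg _ Ax) => /cg.
by rewrite /within /nbhs /= => h; apply: filterS h => y By Ay; change (B (f y)); rewrite fg.
Qed.

(** Pasting along the closed sets [h x <= c] and [c <= h x], which meet only where [h x = c]. *)
Lemma continuous_if_le (T U : topologicalType) (R : realType) (h : T -> R)
    (c : R) (f g : T -> U) :
  continuous h -> continuous f -> continuous g ->
  (forall x, h x = c -> f x = g x) ->
  continuous (fun x => if h x <= c then f x else g x).
Proof.
move=> ch cf cg fg.
have cA : closed (h @^-1` [set y | y <= c]).
  by apply: closed_comp => [x _|]; [exact: ch|exact: closed_le].
have cB : closed (h @^-1` [set y | y >= c]).
  by apply: closed_comp => [x _|]; [exact: ch|exact: closed_ge].
apply/continuous_subspace_setT.
have -> : [set: T] = h @^-1` [set y | y <= c] `|` h @^-1` [set y | y >= c].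
  apply/seteqP; split=> // x _.
  by case: (leP (h x) c) => hx; [left|right; exact: ltW].
apply: withinU_continuous => //.
- by apply: (within_continuous_eq cf) => x /= ->.
- apply: (within_continuous_eq cg) => x /= hx; case: ifP => // hx'.
  by apply: fg; apply/eqP; rewrite eq_le hx hx'.
Qed.

Variables (T : topologicalType) (R : realType).
Implicit Types f g : T -> R.

Lemma ctsD f g : continuous f -> continuous g -> continuous (fun x => f x + g x).
Proof. by move=> cf cg x; apply: continuousD; [exact: cf|exact: cg]. Qed.

Lemma ctsB f g : continuous f -> continuous g -> continuous (fun x => f x - g x).
Proof. by move=> cf cg x; apply: continuousB; [exact: cf|exact: cg]. Qed.

Lemma ctsM f g : continuous f -> continuous g -> continuous (fun x => f x * g x).
Proof. by move=> cf cg x; apply: continuousM; [exact: cf|exact: cg]. Qed.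

Lemma cts_min f g :
  continuous f -> continuous g -> continuous (fun x => Num.min (f x) (g x)).
Proof. by move=> cf cg x; apply: (@continuous_min R T f g); [exact: cf|exact: cg]. Qed.

Lemma cts_max f g :
  continuous f -> continuous g -> continuous (fun x => Num.max (f x) (g x)).
Proof. by move=> cf cg x; apply: (@continuous_max R T f g); [exact: cf|exact: cg]. Qed.

Lemma cts_cst (c : R) : continuous (fun _ : T => c).
Proof. exact: cst_continuous. Qed.

Lemma cts_id : continuous (fun x : T => x).
Proof. by move=> x; exact: cvg_id. Qed.

Lemma cts_pair (U V : topologicalType) (f : T -> U) (g : T -> V) :
  continuous f -> continuous g -> continuous (fun x => (f x, g x)).
Proof. by move=> cf cg x; apply: cvg_pair; [exact: cf|exact: cg]. Qed.

Lemma cts_comp (U V : topologicalType) (f : T -> U) (g : U -> V) :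
  continuous f -> continuous g -> continuous (fun x => g (f x)).
Proof. by move=> cf cg x; apply: continuous_comp; [exact: cf|exact: cg]. Qed.

End Continuity.

Section Clamp.
Variable R : realType.

(** Precomposition with this retraction onto [0,1] turns continuity within [0,1] into continuity on
    all of [R], where sums, products and composites need no domain conditions. *)
Definition clamp (t : R) : R := Num.max 0 (Num.min 1 t).

Lemma clamp_uI t : uI (clamp t).
Proof. by rewrite /uI /clamp /= le_max lexx ge_max ler01 ge_min lexx. Qed.

Lemma clamp_id t : uI t -> clamp t = t.
Proof. by rewrite /uI /clamp /= => /andP[t0 t1]; rewrite min_r // max_r. Qed.

Lemma clamp_continuous : continuous clamp.
Proof.
by apply: cts_max; [|apply: cts_min]; [exact: cts_cst|exact: cts_cst|exact: cts_id].
Qed.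

Definition clamp2 (z : R * R) : R * R := (clamp z.1, clamp z.2).

Lemma clamp2_continuous : continuous clamp2.
Proof.
apply: cts_pair; [apply: (cts_comp (f := fst))|apply: (cts_comp (f := snd))];
  try exact: clamp_continuous.
- by move=> z; exact: cvg_fst.
- by move=> z; exact: cvg_snd.
Qed.

Lemma within_uI_clamp (U : topologicalType) (p : R -> U) :
  {within @uI R, continuous p} <-> continuous (fun t => p (clamp t)).
Proof.
split.
  by apply: within_retract; [exact: clamp_continuous|exact: clamp_uI].
by move=> cp; apply: (within_continuous_eq cp) => t /clamp_id ->.
Qed.

Lemma within_square_clamp (U : topologicalType) (h : R * R -> U) :
  {within @unit_square R, continuous h} <->
  continuous (fun z : R * R => h (clamp2 z)).
Proof.
split.
  apply: within_retract; first exact: clamp2_continuous.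
  by move=> z; split; exact: clamp_uI.
move=> cp; apply: (within_continuous_eq cp) => -[s t] [/= /clamp_id es /clamp_id et].
by rewrite /clamp2 /= es et.
Qed.

Lemma reparam_cts (f : R -> R) : continuous f ->
  (forall t, uI t -> uI (f t)) ->
  (forall s t, uI s -> uI t -> s <= t -> f s <= f t) -> is_reparam f.
Proof.
move=> cf f01 fm; split=> //; split=> //.
by apply: within_continuous_eq cf _.
Qed.

Lemma reparam_id : is_reparam (fun t : R => t).
Proof. by apply: reparam_cts => //; exact: cts_id. Qed.

Lemma reparam_cst (c : R) : uI c -> is_reparam (fun _ : R => c).
Proof. by move=> c01; apply: reparam_cts => //; exact: cts_cst. Qed.

Lemma reparam_comp (f g : R -> R) : is_reparam f -> is_reparam g ->
  is_reparam (fun t => g (f t)).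
Proof.
move=> [f01 [/within_uI_clamp cf fm]] [g01 [/within_uI_clamp cg gm]].
split; first by move=> t /f01 /g01.
split; last by move=> s t hs ht st; apply: gm; [exact: f01|exact: f01|exact: fm].
apply: (within_continuous_eq (cts_comp cf cg)) => t t01.
by rewrite (clamp_id t01) (clamp_id (f01 _ t01)).
Qed.

Lemma reparam_min (f g : R -> R) : is_reparam f -> is_reparam g ->
  is_reparam (fun t => Num.min (f t) (g t)).
Proof.
move=> [f01 [/within_uI_clamp cf fm]] [g01 [/within_uI_clamp cg gm]].
split; first by move=> t t01; case: leP => _; [exact: f01|exact: g01].
split; last first.
  move=> s t hs ht st; rewrite le_min !ge_min (fm _ _ hs ht st).
  by rewrite (gm _ _ hs ht st) orbT.
by apply: (within_continuous_eq (cts_min cf cg)) => t t01; rewrite (clamp_id t01).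
Qed.

(** A convex combination with weight [be u]: for a fixed weight it increases with [al], and it
    increases with the weight because [f <= g]. This makes linear homotopies directed. *)
Lemma reparam_interp (f g al be : R -> R) :
  is_reparam f -> is_reparam g -> is_reparam al -> is_reparam be ->
  (forall t, uI t -> f t <= g t) ->
  is_reparam (fun u => f (al u) + be u * (g (al u) - f (al u))).
Proof.
move=> rf rg ra rb fg.
have [f01 [/within_uI_clamp cf fm]] := reparam_comp ra rf.
have [g01 [/within_uI_clamp cg gm]] := reparam_comp ra rg.
have {}fg t : uI t -> f (al t) <= g (al t) by move=> /(proj1 ra) /fg.
case: rb => [b01 [/within_uI_clamp cb bm]].
split; last split.
- move=> t t01; have := fg _ t01; move: (f01 _ t01) (g01 _ t01) (b01 _ t01).
  by rewrite /uI /= => /andP[? ?] /andP[? ?] /andP[? ?] ?; apply/andP; split; nra.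
- apply: (within_continuous_eq (ctsD cf (ctsM cb (ctsB cg cf)))) => t t01.
  by rewrite (clamp_id t01).
- move=> s t s01 t01 st; move: (fg _ s01) (fg _ t01) (fm _ _ s01 t01 st).
  move: (gm _ _ s01 t01 st) (bm _ _ s01 t01 st) (b01 _ s01) (b01 _ t01).
  move: (f (al s)) (f (al t)) (g (al s)) (g (al t)) (be s) (be t) => F F' G G' b b'.
  rewrite /uI /= => GG bb /andP[b0 b1] /andP[b0' b1'] FG FG' FF.
  have h1 : F + b * (G - F) <= F' + b * (G' - F') by nra.
  by apply: (le_trans h1); nra.
Qed.

End Clamp.

(** * Dipaths and dihomotopies *)

Section Halves.
Variable R : realType.
Implicit Types u : R.

(** The pair ([lo], [hi]) runs along the bottom and then the right side of the unit square; each
    coordinate waits while the other moves. *)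
Definition lo u : R := Num.min (2 * u) 1.
Definition hi u : R := Num.max 0 (2 * u - 1).

Lemma uI0 : uI (0 : R). Proof. by rewrite /uI /= lexx ler01. Qed.
Lemma uI1 : uI (1 : R). Proof. by rewrite /uI /= lexx ler01. Qed.

Lemma lo0 : lo 0 = 0.
Proof. by rewrite /lo mulr0 min_l. Qed.
Lemma lo1 : lo 1 = 1.
Proof. by rewrite /lo mulr1 min_r //; lra. Qed.
Lemma hi0 : hi 0 = 0.
Proof. by rewrite /hi max_l //; lra. Qed.
Lemma hi1 : hi 1 = 1.
Proof. by rewrite /hi max_r; lra. Qed.

Lemma lo_reparam : is_reparam lo.
Proof.
apply: reparam_cts.
- by apply: cts_min; [apply: ctsM; [exact: cts_cst|exact: cts_id]|exact: cts_cst].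
- move=> t /andP[t0 t1]; rewrite /uI /lo /=.
  by case: (leP (2 * t) 1) => h; apply/andP; split; lra.
- move=> s t _ _ st; rewrite /lo le_min !ge_min.
  by rewrite lexx orbT andbT; apply/orP; left; lra.
Qed.

Lemma hi_reparam : is_reparam hi.
Proof.
apply: reparam_cts.
- apply: cts_max; first exact: cts_cst.
  by apply: ctsB; [apply: ctsM; [exact: cts_cst|exact: cts_id]|exact: cts_cst].
- move=> t /andP[t0 t1]; rewrite /uI /hi /=.
  by case: (leP 0 (2 * t - 1)) => h; apply/andP; split; lra.
- move=> s t _ _ st; rewrite /hi ge_max !le_max.
  by rewrite lexx /=; apply/orP; right; lra.
Qed.

(** Indexed by [lo u], [hi u] and [concat p q u] together, so that one case analysis rewrites all
    three. *)
Variant concat_spec_of (T : Type) (p q : R -> T) u : R -> R -> T -> Prop :=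
| ConcatLo of u <= 2^-1 : concat_spec_of p q u (2 * u) 0 (p (2 * u))
| ConcatHi of 2^-1 < u : concat_spec_of p q u 1 (2 * u - 1) (q (2 * u - 1)).

Lemma concatP (T : Type) (p q : R -> T) u :
  concat_spec_of p q u (lo u) (hi u) (concat p q u).
Proof.
rewrite /lo /hi /concat; case: (leP u) => h.
- by rewrite min_l ?max_l; [constructor|lra|lra].
- by rewrite min_r ?max_r; [constructor|lra|lra].
Qed.

(** The unsimplified [0 +] matches the form [al + be * t] of [lift_seg]. *)
Lemma concat_lo (T : Type) (p q : R -> T) u : uI u ->
  concat p q (0 + 2^-1 * u) = p u.
Proof.
move=> /andP[u0 u1]; have h : 0 + 2^-1 * u <= 2^-1 by lra.
by rewrite /concat h; congr p; lra.
Qed.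

Lemma concat_hi (T : Type) (p q : R -> T) u : uI u ->
  p 1 = q 0 -> concat p q (2^-1 + 2^-1 * u) = q u.
Proof.
move=> /andP[u0 u1]; rewrite /concat; case: (ltrgt0P u) u0 => // uc _.
- have h : (2^-1 + 2^-1 * u <= 2^-1) = false by apply/negbTE; rewrite -ltNge; lra.
  by rewrite h => _; congr q; lra.
- by rewrite uc mulr0 addr0 lexx => <-; congr p; lra.
Qed.

Lemma reparam_lin (f g : R -> R) (s a b : R) :
  is_reparam f -> is_reparam g -> 0 <= s -> 0 <= a -> 0 <= b ->
  s + a + b <= 1 -> is_reparam (fun u => s + a * f u + b * g u).
Proof.
move=> [f01 [/within_uI_clamp cf fm]] [g01 [/within_uI_clamp cg gm]] s0 a0 b0 sab.
split; last split.
- move=> t t01; move: (f01 _ t01) (g01 _ t01).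
  by rewrite /uI /= => /andP[? ?] /andP[? ?]; apply/andP; split; nra.
- apply: (within_continuous_eq (ctsD (ctsD (cts_cst (c := s))
    (ctsM (cts_cst (c := a)) cf)) (ctsM (cts_cst (c := b)) cg))) => t t01.
  by rewrite (clamp_id t01).
- move=> x y hx hy xy; move: (fm _ _ hx hy xy) (gm _ _ hx hy xy) => *.
  by nra.
Qed.

Lemma reparam_affine (s t : R) : 0 <= s -> s <= t -> t <= 1 ->
  is_reparam (fun u => s + u * (t - s)).
Proof.
move=> s0 st t1.
have := @reparam_lin _ _ s (t - s) 0 (reparam_id R) (reparam_id R) s0.
move=> h; have {h} : is_reparam (fun u => s + (t - s) * u + 0 * u) by apply: h; lra.
by congr is_reparam; apply/funext => u; rewrite mul0r addr0 mulrC.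
Qed.

(** By the intermediate value theorem a monotone [al] with values on both sides of [c] hits [c].
    This finds the moment at which a path in a square changes halves. *)
Lemma reparam_cross (al : R -> R) (c : R) : is_reparam al ->
  [\/ forall u, uI u -> al u <= c, forall u, uI u -> c <= al u |
   exists u0, [/\ uI u0, forall u, uI u -> u <= u0 -> al u <= c &
     forall u, uI u -> u0 <= u -> c <= al u]].
Proof.
move=> [al01 [cal mal]].
case: (leP (al 1) c) => h1.
  constructor 1 => u u01; apply: le_trans h1.
  by apply: mal => //; [exact: uI1|case/andP: u01].
case: (leP c (al 0)) => h0.
  constructor 2 => u u01; apply: (le_trans h0).
  by apply: mal => //; [exact: uI0|case/andP: u01].
constructor 3.
have cal' : {within `[0, 1], continuous al}.
  suff -> : [set` `[0, 1]] = @uI R by [].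
  by apply/seteqP; split=> x; rewrite /= in_itv.
have [|u0] := IVT ler01 cal' (v := c).
  by rewrite ge_min le_max (ltW h0) (ltW h1) orbT.
rewrite in_itv /= => u01 e; exists u0; split=> //.
- by move=> u hu uu0; rewrite -e; apply: mal.
- by move=> u hu uu0; rewrite -e; apply: mal.
Qed.

End Halves.

Section Dipaths.
Variables (R : realType) (X : topologicalType) (d : dspace R X).
Implicit Types (p q : R -> X) (Y : set X) (a b : X).

Lemma dipath_ext p q : (forall t, uI t -> q t = p t) -> dipath d p -> dipath d q.
Proof. by move=> e dp; apply: (dipath_reparam dp (reparam_id R)). Qed.

(** The axioms of a d-space allow concatenation at [1/2] only; a junction at [u0] is moved there by
    a reparametrisation. *)
Lemma dipath_glue (r p q : R -> X) (u0 : R) : uI u0 ->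
  dipath d p -> dipath d q ->
  (forall u, 0 <= u <= u0 -> r u = p u) ->
  (forall u, u0 <= u <= 1 -> r u = q u) -> dipath d r.
Proof.
move=> /andP[u00 u01] dp dq rp rq.
have [e0|n0] := eqVneq u0 0.
  by apply: dipath_ext dq => t t01; apply: rq; rewrite e0.
have [e1|n1] := eqVneq u0 1.
  by apply: dipath_ext dp => t t01; apply: rp; rewrite e1.
have {n0 u00} u00 : 0 < u0 by rewrite lt_neqAle eq_sym n0.
have {n1 u01} u01 : u0 < 1 by rewrite lt_neqAle n1.
have dp' : dipath d (fun s => p (0 + s * (u0 - 0))).
  have r0 : is_reparam (fun s : R => 0 + s * (u0 - 0)) by apply: reparam_affine; lra.
  exact: dipath_reparam dp r0 _.
have dq' : dipath d (fun s => q (u0 + s * (1 - u0))).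
  have r1 : is_reparam (fun s : R => u0 + s * (1 - u0)) by apply: reparam_affine; lra.
  exact: dipath_reparam dq r1 _.
(* Piecewise linear with [psi 0 = 0], [psi u0 = 1/2] and [psi 1 = 1]. Its slopes [1/(2 u0)] and
   [1/(2 (1 - u0))] are the reason for treating [u0 = 0] and [u0 = 1] apart. *)
pose psi u : R := (2 * u0)^-1 * Num.min u u0 + (2 * (1 - u0))^-1 * Num.max 0 (u - u0).
have i0 : 0 < (2 * u0)^-1 by rewrite invr_gt0; lra.
have i1 : 0 < (2 * (1 - u0))^-1 by rewrite invr_gt0; lra.
have e0 : (2 * u0)^-1 * u0 = 2^-1 by field; lra.
have e1 : (2 * (1 - u0))^-1 * (1 - u0) = 2^-1 by field; lra.
have psi_lo u : u <= u0 -> psi u = (2 * u0)^-1 * u.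
  by move=> h; rewrite /psi min_l // max_l; lra.
have psi_hi u : u0 <= u -> psi u = 2^-1 + (2 * (1 - u0))^-1 * (u - u0).
  by move=> h; rewrite /psi min_r // max_r ?e0 //; lra.
have rpsi : is_reparam psi.
  apply: reparam_cts.
  - apply: ctsD; apply: ctsM; try exact: cts_cst.
      by apply: cts_min; [exact: cts_id|exact: cts_cst].
    by apply: cts_max; [exact: cts_cst|apply: ctsB; [exact: cts_id|exact: cts_cst]].
  - move=> t /andP[t0 t1]; case: (leP t u0) => h.
      by rewrite psi_lo //; apply/andP; split; nra.
    by rewrite psi_hi ?ltW //; apply/andP; split; nra.
  - move=> s t _ _ st; apply: lerD; apply: ler_wpM2l; try exact: ltW.
      by rewrite le_min !ge_min lexx st orbT.
    by rewrite ge_max !le_max lexx /= lerB ?orbT.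
apply: (@dipath_reparam _ _ d _ psi) rpsi _.
  apply: (dipath_concat dp' dq') => //.
  by rewrite mul1r mul0r addr0 add0r subr0 -rp ?rq // lexx ltW.
move=> t /andP[t0 t1]; case: (leP t u0) => h.
- rewrite psi_lo //; case: concatP => h'.
    by rewrite rp ?t0 //; congr p; field; lra.
  by exfalso; nra.
- rewrite psi_hi ?ltW //; case: concatP => h'.
    have : 0 < (2 * (1 - u0))^-1 * (t - u0) by apply: mulr_gt0; lra.
    by move=> ?; exfalso; lra.
  by rewrite rq ?t1 ?ltW //; congr q; field; lra.
Qed.

(** A d-map on the product of two directed intervals: a dipath of the product is a pair of
    reparametrisations. *)
Definition dmap2 (H : R -> R -> X) : Prop :=
  {within @unit_square R, continuous (fun z : R * R => H z.1 z.2)} /\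
  forall al be, is_reparam al -> is_reparam be ->
    dipath d (fun u => H (al u) (be u)).

Lemma dmap2_path p : dipath d p -> dmap2 (fun s _ => p s).
Proof.
move=> dp; split; last by move=> al be ra rb; apply: dipath_reparam dp ra _.
apply/within_square_clamp; have /within_uI_clamp cp := dipath_cont dp.
by apply: (cts_comp (f := fst) _ cp) => z; exact: cvg_fst.
Qed.

(** Linear interpolation between the two curves in the parameter square; [reparam_interp] makes it
    directed, and it never leaves the rectangle spanned by the common endpoints. *)
Lemma dihomotopy_rect H Y (f g f' g' : R -> R) a b :
  dmap2 H -> is_reparam f -> is_reparam g -> is_reparam f' -> is_reparam g' ->
  (forall u, uI u -> f u <= f' u) -> (forall u, uI u -> g u <= g' u) ->
  f 0 = f' 0 -> g 0 = g' 0 -> f 1 = f' 1 -> g 1 = g' 1 ->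
  H (f 0) (g 0) = a -> H (f 1) (g 1) = b ->
  (forall v w, f 0 <= v <= f 1 -> g 0 <= w <= g 1 -> Y (H v w)) ->
  dihomotopy d Y a b (fun u => H (f u) (g u)) (fun u => H (f' u) (g' u)).
Proof.
move=> [cH dH] rf rg rf' rg' ff' gg' f0 g0 f1 g1 Ha Hb HY.
exists (fun u t => H (f u + t * (f' u - f u)) (g u + t * (g' u - g u))).
split; [|split; [|split]].
- apply/within_square_clamp => /=.
  have cl1 : continuous (fun z : R * R => clamp z.1).
    by apply: (cts_comp (f := fst)); [move=> z; exact: cvg_fst|exact: clamp_continuous].
  have cl2 : continuous (fun z : R * R => clamp z.2).
    by apply: (cts_comp (f := snd)); [move=> z; exact: cvg_snd|exact: clamp_continuous].
  have ci (h h' : R -> R) : is_reparam h -> is_reparam h' ->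
     continuous (fun z : R * R =>
       h (clamp z.1) + clamp z.2 * (h' (clamp z.1) - h (clamp z.1))).
    move=> [_ [/within_uI_clamp ch _]] [_ [/within_uI_clamp ch' _]].
    have ch1 : continuous (fun z : R * R => h (clamp z.1)).
      by apply: (cts_comp (f := fst) _ ch) => z; exact: cvg_fst.
    have ch1' : continuous (fun z : R * R => h' (clamp z.1)).
      by apply: (cts_comp (f := fst) _ ch') => z; exact: cvg_fst.
    exact: (ctsD ch1 (ctsM cl2 (ctsB ch1' ch1))).
  have i01 (h h' : R -> R) z : is_reparam h -> is_reparam h' ->
      (forall u, uI u -> h u <= h' u) ->
     uI (h (clamp z.1) + clamp z.2 * (h' (clamp z.1) - h (clamp z.1))).
    move=> rh rh' hh'.
    by have [/(_ 0 (uI0 R))] := reparam_interp rh rh'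
      (reparam_cst (clamp_uI z.1)) (reparam_cst (clamp_uI z.2)) hh'.
  have /within_square_clamp cH' := cH.
  have := cts_comp (cts_pair (ci _ _ rf rf') (ci _ _ rg rg')) cH'.
  move=> cc; apply: (eq_rect _ (fun F : R * R -> X => continuous F) cc).
  apply/funext => z; rewrite /clamp2 /=.
  by rewrite (clamp_id (i01 _ _ z rf rf' ff')) (clamp_id (i01 _ _ z rg rg' gg')).
- by move=> s s01; rewrite !mul0r !mul1r !addr0 !subrKC.
- by move=> t t01; rewrite f0 g0 f1 g1 !subrr !mulr0 !addr0 -f0 -g0 -f1 -g1.
- move=> al be ra rb.
  have rF := reparam_interp rf rf' ra rb ff'.
  have rG := reparam_interp rg rg' ra rb gg'.
  split; first exact: dH.
  have bnd (h h' : R -> R) u : is_reparam h -> is_reparam h' ->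
      (forall u, uI u -> h u <= h' u) -> h 1 = h' 1 -> uI u ->
      h 0 <= h (al u) + be u * (h' (al u) - h (al u)) <= h 1.
    move=> [_ [_ mh]] [_ [_ mh']] hh' e1 u01.
    have a01 := proj1 ra _ u01; have /andP[b0 b1] := proj1 rb _ u01.
    have /andP[a0 a1] := a01.
    have := hh' _ a01; have := mh _ _ (uI0 R) a01 a0.
    have := mh' _ _ a01 (uI1 R) a1; rewrite -e1 => *.
    by apply/andP; split; nra.
  by move=> u u01; apply: HY; apply: bnd.
Qed.

Lemma dhequiv_rect H Y (f g f' g' : R -> R) a b :
  dmap2 H -> is_reparam f -> is_reparam g -> is_reparam f' -> is_reparam g' ->
  f 0 = f' 0 -> g 0 = g' 0 -> f 1 = f' 1 -> g 1 = g' 1 ->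
  H (f 0) (g 0) = a -> H (f 1) (g 1) = b ->
  (forall v w, f 0 <= v <= f 1 -> g 0 <= w <= g 1 -> Y (H v w)) ->
  dhequiv d Y a b (fun u => H (f u) (g u)) (fun u => H (f' u) (g' u)).
Proof.
move=> dH rf rg rf' rg' f0 g0 f1 g1 Ha Hb HY.
pose m u := H (Num.min (f u) (f' u)) (Num.min (g u) (g' u)).
have rm := reparam_min rf rf'; have rn := reparam_min rg rg'.
apply: (rst_trans _ _ _ m).
- apply: rst_sym; apply: rst_step; apply: dihomotopy_rect => //;
    rewrite ?f0 ?f1 ?g0 ?g1 ?minxx -?f0 -?f1 -?g0 -?g1 //.
  + by move=> u _; rewrite ge_min lexx.
  + by move=> u _; rewrite ge_min lexx.
- apply: rst_step; apply: dihomotopy_rect => //;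
    rewrite ?f0 ?f1 ?g0 ?g1 ?minxx -?f0 -?f1 -?g0 -?g1 //.
  + by move=> u _; rewrite ge_min lexx orbT.
  + by move=> u _; rewrite ge_min lexx orbT.
Qed.

Lemma dhequiv_reparam p Y (f f' : R -> R) a b :
  dipath d p -> is_reparam f -> is_reparam f' ->
  f 0 = f' 0 -> f 1 = f' 1 -> p (f 0) = a -> p (f 1) = b ->
  (forall v, f 0 <= v <= f 1 -> Y (p v)) ->
  dhequiv d Y a b (fun u => p (f u)) (fun u => p (f' u)).
Proof.
move=> dp rf rf' f0 f1 pa pb Yp.
apply: (@dhequiv_rect (fun s _ => p s) Y f f f' f') => //; first exact: dmap2_path.
by move=> v w hv _; apply: Yp.
Qed.

Lemma is_dipath_from_ext Y a b p q : (forall t, uI t -> q t = p t) ->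
  is_dipath_from d Y a b p -> is_dipath_from d Y a b q.
Proof.
move=> e [[dp Yp] [p0 p1]]; split; last by rewrite (e _ (uI0 R)) (e _ (uI1 R)).
by split; [exact: dipath_ext dp|move=> t t01; rewrite e //; exact: Yp].
Qed.

(** Paths are functions on [R], so paths equal on [0,1] may be distinct. The homotopy constant in
    time joins them, because its end rows are read on [0,1] only. *)
Lemma dhequiv_ext Y a b p q : is_dipath_from d Y a b p ->
  (forall t, uI t -> q t = p t) -> dhequiv d Y a b p q.
Proof.
move=> [[dp Yp] [p0 p1]] e; apply: rst_step; exists (fun s _ => p s).
have [cp dp2] := dmap2_path dp; split=> //; split; first by move=> s /e.
split=> // al be ra rb; split; first exact: (dp2 al be ra rb).
by move=> t /(proj1 ra) /Yp.
Qed.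

Lemma dihomotopy_from Y a b p q : dihomotopy d Y a b p q ->
  is_dipath_from d Y a b p /\ is_dipath_from d Y a b q.
Proof.
move=> [H [_ [H01 [Hab HY]]]].
have e0 := Hab _ (uI0 R); have e1 := Hab _ (uI1 R).
split.
- have h := HY _ _ (reparam_id R) (reparam_cst (uI0 R)).
  apply: (@is_dipath_from_ext _ _ _ (fun u => H u 0)); first by move=> t /H01 [].
  by split=> //; case: e0.
- have h := HY _ _ (reparam_id R) (reparam_cst (uI1 R)).
  apply: (@is_dipath_from_ext _ _ _ (fun u => H u 1)); first by move=> t /H01 [].
  by split=> //; case: e1.
Qed.

Lemma dhequiv_from Y a b p q : dhequiv d Y a b p q ->
  is_dipath_from d Y a b p <-> is_dipath_from d Y a b q.
Proof.
elim=> {p q} [p q /dihomotopy_from [hp hq]|p|p q _ ->|p q r _ -> _ ->] //.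
Qed.

Lemma dhequiv_sub Y Y' a b p q : Y `<=` Y' ->
  dhequiv d Y a b p q -> dhequiv d Y' a b p q.
Proof.
move=> YY'; elim=> {p q} [p q|p|p q _|p q r _ h1 _ h2].
- move=> [H [cH [H01 [Hab HY]]]]; apply: rst_step; exists H; split=> //; split=> //.
  split=> // al be ra rb; have [h1 h2] := HY al be ra rb.
  by split=> // t /h2 /YY'.
- exact: rst_refl.
- exact: rst_sym.
- exact: rst_trans h1 h2.
Qed.

Lemma dihomotopy_concat Y a b c p p' q q' :
  dihomotopy d Y a b p p' -> dihomotopy d Y b c q q' ->
  dihomotopy d Y a c (concat p q) (concat p' q').
Proof.
move=> [H [cH [H01 [Hab HY]]]] [K [cK [K01 [Kbc KY]]]].
have e21 : 2 * 2^-1 = 1 :> R by lra.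
(* The two squares side by side. Clamping makes both branches continuous on the whole plane, so they
   can be pasted there. *)
pose L s t := if s <= 2^-1 :> R then H (clamp (2 * s)) (clamp t)
              else K (clamp (2 * s - 1)) (clamp t).
have Llo s t : uI s -> uI t -> s <= 2^-1 -> L s t = H (lo s) t.
  move=> /andP[s0 s1] t01 hs; rewrite /L hs /lo min_l ?clamp_id //; last lra.
  by apply/andP; split; lra.
have Lhi s t : uI s -> uI t -> 2^-1 <= s -> L s t = K (hi s) t.
  move=> /andP[s0 s1] t01 hs; rewrite /L /hi; case: ifP => hs'.
    have -> : s = 2^-1 by apply/eqP; rewrite eq_le hs hs'.
    rewrite e21 subrr maxxx !clamp_id //; last exact: uI1.
    by rewrite (proj2 (Hab _ t01)) (proj1 (Kbc _ t01)).
  rewrite max_r ?clamp_id //; last lra.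
  by apply/andP; split; lra.
exists L; split; [|split; [|split]].
- apply: continuous_subspaceT; apply: (continuous_if_le (h := fst)).
  + by move=> z; exact: cvg_fst.
  + have /within_square_clamp cH' := cH.
    apply: (cts_comp (f := fun z : R * R => (2 * z.1, z.2)) _ cH').
    apply: cts_pair; last by move=> z; exact: cvg_snd.
    by apply: ctsM; [exact: cts_cst|move=> z; exact: cvg_fst].
  + have /within_square_clamp cK' := cK.
    apply: (cts_comp (f := fun z : R * R => (2 * z.1 - 1, z.2)) _ cK').
    apply: cts_pair; last by move=> z; exact: cvg_snd.
    apply: ctsB; last exact: cts_cst.
    by apply: ctsM; [exact: cts_cst|move=> z; exact: cvg_fst].
  + move=> z /= ->; rewrite e21 subrr (clamp_id (uI0 R)) (clamp_id (uI1 R)).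
    by rewrite (proj2 (Hab _ (clamp_uI _))) (proj1 (Kbc _ (clamp_uI _))).
- move=> s s01; have /andP[s0 s1] := s01.
  have u_lo : s <= 2^-1 -> uI (2 * s) by move=> ?; apply/andP; split; lra.
  have u_hi : 2^-1 < s -> uI (2 * s - 1) by move=> ?; apply/andP; split; lra.
  have e_lo : s <= 2^-1 -> lo s = 2 * s by move=> ?; rewrite /lo min_l //; lra.
  have e_hi : 2^-1 < s -> hi s = 2 * s - 1 by move=> ?; rewrite /hi max_r //; lra.
  split; case: concatP => hs.
  + by rewrite (Llo _ _ s01 (uI0 R) hs) e_lo //; case: (H01 _ (u_lo hs)).
  + by rewrite (Lhi _ _ s01 (uI0 R) (ltW hs)) e_hi //; case: (K01 _ (u_hi hs)).
  + by rewrite (Llo _ _ s01 (uI1 R) hs) e_lo //; case: (H01 _ (u_lo hs)).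
  + by rewrite (Lhi _ _ s01 (uI1 R) (ltW hs)) e_hi //; case: (K01 _ (u_hi hs)).
- move=> t t01; rewrite Llo //; [|exact: uI0|lra].
  rewrite Lhi //; [|exact: uI1|lra].
  by rewrite lo0 hi1; split; [apply Hab|apply Kbc].
- move=> al be ra rb.
  have [dP YP] := HY _ _ (reparam_comp ra (lo_reparam R)) rb.
  have [dQ YQ] := KY _ _ (reparam_comp ra (hi_reparam R)) rb.
  have al01 := proj1 ra; have be01 := proj1 rb.
  split; last first.
    move=> t t01; case: (leP (al t) 2^-1) => h.
      by rewrite Llo //; [exact: YP|exact: al01|exact: be01].
    by rewrite Lhi ?ltW //; [exact: YQ|exact: al01|exact: be01].
  (* Being monotone, [al] passes from the square of [H] to that of [K] at most once; [dipath_glue]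
     joins the two parts at that moment. *)
  case: (reparam_cross 2^-1 ra) => [h|h|[u0 [u01 h1 h2]]].
  + by apply: dipath_ext dP => t t01; rewrite Llo //; [exact: al01|exact: be01|exact: h].
  + by apply: dipath_ext dQ => t t01; rewrite Lhi //; [exact: al01|exact: be01|exact: h].
  + have /andP[u00 u0le1] := u01.
    apply: (dipath_glue u01 dP dQ) => u /andP[hu1 hu2].
    * have u_uI : uI u by rewrite /uI /= hu1 (le_trans hu2).
      by rewrite Llo //; [exact: al01|exact: be01|exact: h1].
    * have u_uI : uI u by rewrite /uI /= hu2 (le_trans u00).
      by rewrite Lhi //; [exact: al01|exact: be01|exact: h2].
Qed.

Lemma dihomotopy_refl Y a b p : is_dipath_from d Y a b p -> dihomotopy d Y a b p p.
Proof.
move=> [[dp Yp] [p0 p1]]; exists (fun s _ => p s).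
have [cp dp2] := dmap2_path dp; split=> //; split=> //; split=> // al be ra rb.
by split; [exact: (dp2 al be ra rb)|move=> t /(proj1 ra) /Yp].
Qed.

Lemma dhequiv_concat Y a b c p p' q q' :
  is_dipath_from d Y a b p -> is_dipath_from d Y b c q ->
  dhequiv d Y a b p p' -> dhequiv d Y b c q q' ->
  dhequiv d Y a c (concat p q) (concat p' q').
Proof.
move=> hp hq pp' qq'; apply: (rst_trans _ _ _ (concat p' q)).
- elim: pp' {hp} => {p p'} [p p' h|p|p p' _|p p' p'' _ h1 _ h2].
  + by apply: rst_step; exact: dihomotopy_concat h (dihomotopy_refl hq).
  + exact: rst_refl.
  + exact: rst_sym.
  + exact: rst_trans h1 h2.
- have {hp pp'} hp := proj1 (dhequiv_from pp') hp.
  elim: qq' {hq} => {q q'} [q q' h|q|q q' _|q q' q'' _ h1 _ h2].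
  + by apply: rst_step; exact: dihomotopy_concat (dihomotopy_refl hp) h.
  + exact: rst_refl.
  + exact: rst_sym.
  + exact: rst_trans h1 h2.
Qed.

Definition restr p (s t : R) : R -> X := fun u => p (s + u * (t - s)).

Lemma restr_from Y p s t : dipath d p -> 0 <= s -> s <= t -> t <= 1 ->
  (forall u, s <= u <= t -> Y (p u)) -> is_dipath_from d Y (p s) (p t) (restr p s t).
Proof.
move=> dp s0 st t1 Yp; split; last first.
  by rewrite /restr mul0r addr0 mul1r subrKC.
split; first exact: dipath_reparam dp (reparam_affine s0 st t1) _.
by move=> u /andP[u0 u1]; apply: Yp; apply/andP; split; nra.
Qed.

Lemma restr_split Y p s t r : dipath d p -> 0 <= s -> s <= t -> t <= r -> r <= 1 ->
  (forall u, s <= u <= r -> Y (p u)) ->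
  dhequiv d Y (p s) (p r) (restr p s r) (concat (restr p s t) (restr p t r)).
Proof.
move=> dp s0 st tr r1 Yp.
(* [f] runs from [s] to [t] in the first half and from [t] to [r] in the second, so [p] after [f] is
   the concatenation itself; [restr p s r] is [p] after another reparametrisation with the same
   ends. *)
pose f u : R := s + (t - s) * lo u + (r - t) * hi u.
have rf : is_reparam f.
  by apply: reparam_lin; [exact: lo_reparam|exact: hi_reparam|lra..].
have f0 : f 0 = s by rewrite /f lo0 hi0; lra.
have f1 : f 1 = r by rewrite /f lo1 hi1; lra.
have e : dhequiv d Y (p s) (p r) (restr p s r) (fun u => p (f u)).
  apply: dhequiv_reparam => //; rewrite ?f0 ?f1 ?mul0r ?mul1r ?addr0 ?subrKC //.
  by apply: reparam_affine; lra.
apply: (rst_trans _ _ _ _ _ e); apply: dhequiv_ext.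
  apply: (proj1 (dhequiv_from e)); apply: restr_from => //; lra.
by move=> u u01; rewrite /f; case: concatP => h; rewrite /restr; congr p; lra.
Qed.

Lemma dhequiv_square H Y s0 s1 t0 t1 : dmap2 H ->
  0 <= s0 -> s0 <= s1 -> s1 <= 1 -> 0 <= t0 -> t0 <= t1 -> t1 <= 1 ->
  (forall v w, s0 <= v <= s1 -> t0 <= w <= t1 -> Y (H v w)) ->
  dhequiv d Y (H s0 t0) (H s1 t1)
    (concat (restr (fun s => H s t0) s0 s1) (restr (H s1) t0 t1))
    (concat (restr (H s0) t0 t1) (restr (fun s => H s t1) s0 s1)).
Proof.
move=> dH s00 s01 s11 t00 t01 t11 HY.
(* ([f lo], [g hi]) is bottom then right, ([f hi], [g lo]) is left then top. The vanishing last term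
   gives both the form of [reparam_lin]. *)
pose f h (u : R) : R := s0 + (s1 - s0) * h u + 0 * h u.
pose g h (u : R) : R := t0 + (t1 - t0) * h u + 0 * h u.
have rf h : is_reparam h -> is_reparam (f h) by move=> rh; apply: reparam_lin => //; lra.
have rg h : is_reparam h -> is_reparam (g h) by move=> rh; apply: reparam_lin => //; lra.
have rl := @lo_reparam R; have rh := @hi_reparam R.
have fl0 : f (@lo R) 0 = s0 by rewrite /f lo0; lra.
have fh0 : f (@hi R) 0 = s0 by rewrite /f hi0; lra.
have fl1 : f (@lo R) 1 = s1 by rewrite /f lo1; lra.
have fh1 : f (@hi R) 1 = s1 by rewrite /f hi1; lra.
have gl0 : g (@lo R) 0 = t0 by rewrite /g lo0; lra.
have gh0 : g (@hi R) 0 = t0 by rewrite /g hi0; lra.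
have gl1 : g (@lo R) 1 = t1 by rewrite /g lo1; lra.
have gh1 : g (@hi R) 1 = t1 by rewrite /g hi1; lra.
have e : dhequiv d Y (H s0 t0) (H s1 t1) (fun u => H (f (@lo R) u) (g (@hi R) u))
    (fun u => H (f (@hi R) u) (g (@lo R) u)).
  have rfl := rf _ rl; have rgl := rg _ rl; have rfh := rf _ rh; have rgh := rg _ rh.
  by apply: dhequiv_rect; rewrite ?fl0 ?fh0 ?fl1 ?fh1 ?gl0 ?gh0 ?gl1 ?gh1.
have eta : is_dipath_from d Y (H s0 t0) (H s1 t1) (fun u => H (f (@lo R) u) (g (@hi R) u)).
  split; last by rewrite fl0 fl1 gh0 gh1.
  split; first by apply: (proj2 dH); [exact: rf|exact: rg].
  move=> u u01; move: (proj1 rl _ u01) (proj1 rh _ u01) => /andP[? ?] /andP[? ?].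
  by apply: HY; rewrite /f /g; apply/andP; split; nra.
apply: (rst_trans _ _ _ (fun u => H (f (@lo R) u) (g (@hi R) u))).
  apply: rst_sym; apply: dhequiv_ext => // u u01; rewrite /f /g.
  by case: concatP => h; rewrite /restr; congr H; lra.
apply: (rst_trans _ _ _ _ _ e); apply: dhequiv_ext; first exact/(dhequiv_from e).
move=> u u01; rewrite /f /g.
by case: concatP => h; rewrite /restr; congr H; lra.
Qed.

Lemma concat_cst_l Y a b p : is_dipath_from d Y a b p ->
  dhequiv d Y a b (concat (fun _ => a) p) p.
Proof.
move=> hp; have [[dp Yp] [p0 p1]] := hp.
have e : dhequiv d Y a b (fun u => p u) (fun u => p (hi u)).
  by apply: dhequiv_reparam => //; rewrite ?hi0 ?hi1 //; [exact: reparam_id|exact: hi_reparam].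
apply: rst_sym; apply: (rst_trans _ _ _ _ _ e); apply: dhequiv_ext.
  exact/(dhequiv_from e).
by move=> u u01; case: concatP => h; rewrite ?p0.
Qed.

Lemma concat_cst_r Y a b p : is_dipath_from d Y a b p ->
  dhequiv d Y a b (concat p (fun _ => b)) p.
Proof.
move=> hp; have [[dp Yp] [p0 p1]] := hp.
have e : dhequiv d Y a b (fun u => p u) (fun u => p (lo u)).
  by apply: dhequiv_reparam => //; rewrite ?lo0 ?lo1 //; [exact: reparam_id|exact: lo_reparam].
apply: rst_sym; apply: (rst_trans _ _ _ _ _ e); apply: dhequiv_ext.
  exact/(dhequiv_from e).
by move=> u u01; case: concatP => h; rewrite ?p1.
Qed.

(* The two bracketings differ by the convex piecewise linear reparametrisation
   with slopes [1/2], [1], [2]. *)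
Lemma concat_assoc Y a b c e p q r : is_dipath_from d Y a b p ->
  is_dipath_from d Y b c q -> is_dipath_from d Y c e r ->
  dhequiv d Y a e (concat (concat p q) r) (concat p (concat q r)).
Proof.
move=> hp hq hr.
have hm := concat_spec (concat_spec hp hq) hr.
set m := concat _ r in hm *; have [[dm Ym] [m0 m1]] := hm.
pose f u : R := Num.max (2^-1 * u) (Num.max (u - 4^-1) (2 * u - 1)).
have f1 u : u <= 2^-1 -> f u = 2^-1 * u.
  by move=> h; rewrite /f max_l // ge_max; apply/andP; split; lra.
have f2 u : 2^-1 <= u -> u <= 3 / 4 -> f u = u - 4^-1.
  by move=> h h'; rewrite /f (max_l (x := u - _)) ?max_r //; lra.
have f3 u : 3 / 4 <= u -> f u = 2 * u - 1.
  by move=> h; rewrite /f (max_r (x := u - _)) ?max_r //; lra.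
have rf : is_reparam f.
  apply: reparam_cts.
  - apply: cts_max; first by apply: ctsM; [exact: cts_cst|exact: cts_id].
    apply: cts_max; first by apply: ctsB; [exact: cts_id|exact: cts_cst].
    by apply: ctsB; [apply: ctsM|]; [exact: cts_cst|exact: cts_id|exact: cts_cst].
  - move=> t /andP[t0 t1]; apply/andP.
    by rewrite /f le_max !ge_max; split; [apply/orP; left|repeat (apply/andP; split)]; lra.
  - move=> s t _ _ st; rewrite /f !ge_max !le_max.
    by apply/andP; split; [|apply/andP; split]; apply/orP;
      [left|right; apply/orP; left|right; apply/orP; right]; lra.
have f0 : 0 = f 0 by rewrite f1; lra.
have f_1 : 1 = f 1 by rewrite f3; lra.
have h : dhequiv d Y a e (fun u => m u) (fun u => m (f u)).
  by apply: dhequiv_reparam => //; exact: reparam_id.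
apply: (rst_trans _ _ _ _ _ h); apply: dhequiv_ext; first exact/(dhequiv_from h).
move=> u /andP[u0 u1]; clear m0 m1; case: concatP => hu; last first.
  case: concatP => hu'.
  - rewrite f2 ?(ltW hu) //; last lra.
    rewrite /m; case: concatP => k; last by exfalso; lra.
    by case: concatP => k'; [exfalso; lra|]; congr q; lra.
  - rewrite f3; last lra.
    rewrite /m; case: concatP => k; first by exfalso; lra.
    by congr r; lra.
rewrite f1 // /m; case: concatP => k; last by exfalso; lra.
by case: concatP => k'; [congr p; lra|exfalso; lra].
Qed.

End Dipaths.

(** * Lebesgue numbers *)

Section Lebesgue.
Variables (R : realType) (X : topologicalType) (Y : bool -> set X).

(** Compactness in its near-covering form yields one [n] that serves all points of the square at
    once; a cell is then addressed by its lower left corner. *)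
Lemma lebesgue_grid (H : R -> R -> X) :
  [set: X] = interior (Y true) `|` interior (Y false) ->
  {within @unit_square R, continuous (fun z : R * R => H z.1 z.2)} ->
  exists N : nat, forall x y, uI x -> uI y -> exists k, forall s t,
    x <= s <= x + N.+1%:R^-1 -> y <= t <= y + N.+1%:R^-1 ->
    uI s -> uI t -> Y k (H s t).
Proof.
move=> cover /within_square_clamp; set g := (fun z => _) => cg.
pose P (n : nat) (z : R * R) := exists k, forall w : R * R,
  `|z.1 - w.1| <= n.+1%:R^-1 -> `|z.2 - w.2| <= n.+1%:R^-1 -> Y k (g w).
have half (x y z e r : R) : `|x - y| < r / 2 -> `|y - z| <= e -> e < r / 2 ->
    `|x - z| < r by have := ler_distD y x z; lra.
have dist (x s e : R) : x <= s -> s <= x + e -> `|x - s| <= e.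
  by move=> ? ?; rewrite ler_distlC; apply/andP; split; lra.
have cK : compact (`[0, 1]%classic `*` `[0, 1]%classic : set (R * R)).
  by apply: compact_setX; exact: segment_compact.
have := proj1 (compact_near_coveringP _) cK nat \oo P _.
case.
  move=> z _.
  have [k] : exists k, interior (Y k) (g z).
    have : [set: X] (g z) by [].
    by rewrite cover => -[]; [exists true|exists false].
  move/cg/nbhs_ballP => [r /= r0 rY].
  have r2 : 0 < r / 2 by apply: divr_gt0.
  (* One half of [r] is spent on moving the centre from [z] to [w], the other on the small square
     about [w]. *)
  exists (ball z (r / 2), [set n : nat | n.+1%:R^-1 < r / 2]) => /=.
    split; first exact: nbhsx_ballx.
    exact: (near_infty_natSinv_lt (interval_inference.PosNum r2)).
  move=> [w n] [/= [zw1 zw2] nr]; exists k => v /= wv1 wv2.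
  have {}nr : n.+1%:R^-1 < r / 2 :> R by [].
  by apply: rY; split; [exact: half zw1 wv1 nr|exact: half zw2 wv2 nr].
move=> N _ hN; exists N => x y x01 y01.
have [|k hk] := hN N (leqnn N) (x, y).
  by split; rewrite /= in_itv.
exists k => s t /andP[xs sx] /andP[yt ty] s01 t01.
have := hk (s, t); rewrite /g /clamp2 /= !clamp_id //; apply.
- exact: dist xs sx.
- exact: dist yt ty.
Qed.

End Lebesgue.

(** * Fundamental categories *)

Section Arrows.

Lemma sig_eq (T : Type) (P : T -> Prop) (a b : {x | P x}) :
  proj1_sig a = proj1_sig b -> a = b.
Proof.
by case: a b => [x px] [y py] /= e; subst y; rewrite (Prop_irrelevance px py).
Qed.

(* Arrows are bundled with their endpoints in order to compare arrows whose
   endpoints are only propositionally equal. *)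
Definition arr (C : precat) (a b : ob C) (f : hom C a b) :
    {ab : ob C * ob C & hom C ab.1 ab.2} :=
  existT (fun ab : ob C * ob C => hom C ab.1 ab.2) (a, b) f.

Lemma arr_inj (C : precat) (a b : ob C) (f g : hom C a b) :
  arr f = arr g -> f = g.
Proof. exact: inj_pair2. Qed.

Lemma arr_dom (C : precat) (a b a' b' : ob C) (f : hom C a b) (f' : hom C a' b') :
  arr f = arr f' -> a = a'.
Proof. by move=> e; have /(congr1 fst) := projT1_eq e. Qed.

Lemma arr_cod (C : precat) (a b a' b' : ob C) (f : hom C a b) (f' : hom C a' b') :
  arr f = arr f' -> b = b'.
Proof. by move=> e; have /(congr1 snd) := projT1_eq e. Qed.

Lemma arr_comp (C : precat) (a b c a' b' c' : ob C) (f : hom C a b)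
    (g : hom C b c) (f' : hom C a' b') (g' : hom C b' c') :
  arr f = arr f' -> arr g = arr g' -> arr (Defs.comp f g) = arr (Defs.comp f' g').
Proof.
move=> ef eg; have ea := arr_dom ef; have eb := arr_cod ef; have ec := arr_cod eg.
subst a' b' c'; by rewrite (arr_inj ef) (arr_inj eg).
Qed.

Lemma arr_fmap (C D : precat) (F : functor C D) (a b a' b' : ob C)
    (f : hom C a b) (f' : hom C a' b') :
  arr f = arr f' -> arr (fmap F f) = arr (fmap F f').
Proof.
move=> e; have ea := arr_dom e; have eb := arr_cod e.
by subst a' b'; rewrite (arr_inj e).
Qed.

Lemma functor_arr (C D : precat) (F G : functor C D) (a b : ob C) (f : hom C a b) :
  F = G -> arr (fmap F f) = arr (fmap G f).
Proof. by move=> ->. Qed.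

(** The bundled image of an identity records its domain, so agreement on bundled arrows also forces
    the object maps to agree. *)
Lemma functor_ext (C D : precat) (F G : functor C D) :
  (forall a b (f : hom C a b), arr (fmap F f) = arr (fmap G f)) -> F = G.
Proof.
case: F G => [o m] [o' m'] /= e.
have eo : o = o' by apply/funext => a; exact: arr_dom (e a a (idm a)).
subst o'; congr Functor.
by apply: functional_extensionality_dep => a; apply: functional_extensionality_dep => b;
  apply: functional_extensionality_dep => f; exact: arr_inj (e a b f).
Qed.

Lemma is_functor_fcomp (C D E : precat) (F : functor C D) (G : functor D E) :
  is_functor F -> is_functor G -> is_functor (fcomp F G).
Proof.
move=> [F1 FM] [G1 GM]; split; first by move=> a /=; rewrite F1 G1.
by move=> a b c f g /=; rewrite FM GM.
Qed.

End Arrows.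

Section FundamentalCategory.
Variables (R : realType) (X : topologicalType) (d : dspace R X).
Implicit Types (p q : R -> X) (Y Z : set X) (a b c : X).

Definition cls Y a b p (h : is_dipath_from d Y a b p) : pihom d Y a b :=
  exist _ (dclass d Y a b p) (ex_intro _ p (conj h erefl)).

Lemma cls_eq Y a b p q (hp : is_dipath_from d Y a b p)
    (hq : is_dipath_from d Y a b q) :
  dhequiv d Y a b p q -> cls hp = cls hq.
Proof.
move=> pq; apply: sig_eq; apply/funext => r /=; apply/propext; split=> h.
- by apply: rst_trans h; apply: rst_sym.
- exact: rst_trans pq h.
Qed.

Lemma cls_rep Y a b (f : pihom d Y a b) : cls (rep_spec f) = f.
Proof.
apply: sig_eq => /=; rewrite /rep.
by case: (ClassicalEpsilon.constructive_indefinite_description _ _) => p [_ e] /=.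
Qed.

Lemma rep_cls Y a b p (h : is_dipath_from d Y a b p) :
  dhequiv d Y a b (rep (cls h)) p.
Proof.
have /(congr1 (fun f : pihom d Y a b => proj1_sig f p)) /= e := cls_rep (cls h).
by change (dclass d Y a b (rep (cls h)) p); rewrite e; exact: rst_refl.
Qed.

Lemma pi_comp_cls Y a b c p q (hp : is_dipath_from d Y a b p)
    (hq : is_dipath_from d Y b c q) :
  pi_comp (cls hp) (cls hq) = cls (concat_spec hp hq).
Proof.
apply: cls_eq; apply: dhequiv_concat; try exact: rep_spec.
- exact: rep_cls.
- exact: rep_cls.
Qed.

Lemma pi_comp1l Y a b (Ya : Y a) (f : pihom d Y a b) : pi_comp (pi_id d Ya) f = f.
Proof.
rewrite -(cls_rep f) (pi_comp_cls (const_spec d Ya)); apply: cls_eq.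
exact: concat_cst_l (rep_spec f).
Qed.

Lemma pi_comp1r Y a b (Yb : Y b) (f : pihom d Y a b) : pi_comp f (pi_id d Yb) = f.
Proof.
rewrite -(cls_rep f) (pi_comp_cls _ (const_spec d Yb)); apply: cls_eq.
exact: concat_cst_r (rep_spec f).
Qed.

Lemma pi_compA Y a b c e (f : pihom d Y a b) (g : pihom d Y b c) (h : pihom d Y c e) :
  pi_comp (pi_comp f g) h = pi_comp f (pi_comp g h).
Proof.
rewrite -(cls_rep f) -(cls_rep g) -(cls_rep h) !pi_comp_cls; apply: cls_eq.
exact: concat_assoc (rep_spec f) (rep_spec g) (rep_spec h).
Qed.

Lemma pi1_category Y Z (hZ : Z `<=` Y) : is_category (pi1 d hZ).
Proof.
split; first by move=> a b f; exact: pi_comp1l.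
by split; [move=> a b f; exact: pi_comp1r|move=> *; exact: pi_compA].
Qed.

(** The morphism part of [incl] with endpoints read in [X]: it does not see which points serve as
    objects. *)
Definition up Y Y' (hY : Y `<=` Y') a b (f : pihom d Y a b) : pihom d Y' a b :=
  cls (dipath_from_sub hY (rep_spec f)).

Lemma up_cls Y Y' (hY : Y `<=` Y') a b p (h : is_dipath_from d Y a b p)
    (h' : is_dipath_from d Y' a b p) : up hY (cls h) = cls h'.
Proof. by apply: cls_eq; apply: (dhequiv_sub hY); exact: rep_cls. Qed.

Lemma up_refl Y (hY : Y `<=` Y) a b (f : pihom d Y a b) : up hY f = f.
Proof. by rewrite -[RHS]cls_rep; exact: cls_eq (rst_refl _ _ _). Qed.

Lemma up_up Y Y' Y'' (h : Y `<=` Y') (h' : Y' `<=` Y'') (h'' : Y `<=` Y'') a b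
    (f : pihom d Y a b) : up h' (up h f) = up h'' f.
Proof. exact: up_cls. Qed.

Lemma up_comp Y Y' (hY : Y `<=` Y') a b c (f : pihom d Y a b) (g : pihom d Y b c) :
  up hY (pi_comp f g) = pi_comp (up hY f) (up hY g).
Proof. by rewrite [RHS]pi_comp_cls; exact: up_cls. Qed.

Lemma up_id Y Y' (hY : Y `<=` Y') a (Ya : Y a) (Ya' : Y' a) :
  up hY (pi_id d Ya) = pi_id d Ya'.
Proof. exact: up_cls. Qed.

Lemma incl_functor Y1 Z1 Y2 Z2 (h1 : Z1 `<=` Y1) (h2 : Z2 `<=` Y2)
    (hY : Y1 `<=` Y2) (hZ : Z1 `<=` Z2) : is_functor (incl d h1 h2 hY hZ).
Proof. by split=> [a|a b c f g]; [exact: up_id|exact: up_comp]. Qed.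

(** Endpoints are taken in [X] rather than in a subtype, so that morphisms of [pi1] for different
    sets of objects become comparable. *)
Definition parr Y a b (f : pihom d Y a b) :
    {ab : X * X & pihom d Y ab.1 ab.2} :=
  existT (fun ab : X * X => pihom d Y ab.1 ab.2) (a, b) f.

Lemma parr_cod Y a b a' b' (f : pihom d Y a b) (f' : pihom d Y a' b') :
  parr f = parr f' -> b = b'.
Proof. by move=> e; have /(congr1 snd) := projT1_eq e. Qed.

Lemma parr_dom Y a b a' b' (f : pihom d Y a b) (f' : pihom d Y a' b') :
  parr f = parr f' -> a = a'.
Proof. by move=> e; have /(congr1 fst) := projT1_eq e. Qed.

Lemma parr_inj Y a b (f f' : pihom d Y a b) : parr f = parr f' -> f = f'.
Proof. exact: inj_pair2. Qed.

Lemma parr_comp Y a b c a' b' c' (f : pihom d Y a b) (g : pihom d Y b c)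
    (f' : pihom d Y a' b') (g' : pihom d Y b' c') :
  parr f = parr f' -> parr g = parr g' -> parr (pi_comp f g) = parr (pi_comp f' g').
Proof.
move=> ef eg; have ea := parr_dom ef; have eb := parr_cod ef; have ec := parr_cod eg.
by subst a' b' c'; rewrite (parr_inj ef) (parr_inj eg).
Qed.

Lemma parr_up Y Y' (hY : Y `<=` Y') a b a' b' (f : pihom d Y a b)
    (f' : pihom d Y a' b') :
  parr f = parr f' -> parr (up hY f) = parr (up hY f').
Proof.
move=> e; have ea := parr_dom e; have eb := parr_cod e; subst a' b'.
by rewrite (parr_inj e).
Qed.

Lemma parr_id Y a b (Ya : Y a) (Yb : Y b) : a = b ->
  parr (pi_id d Ya) = parr (pi_id d Yb).
Proof. by move=> e; subst b; rewrite (Prop_irrelevance Ya Yb). Qed.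

Lemma arr_of_parr Y Z (hZ : Z `<=` Y) (a b a' b' : ob (pi1 d hZ))
    (f : hom (pi1 d hZ) a b) (f' : hom (pi1 d hZ) a' b') :
  parr (f : pihom d Y (proj1_sig a) (proj1_sig b)) =
  parr (f' : pihom d Y (proj1_sig a') (proj1_sig b')) -> arr f = arr f'.
Proof.
move=> e; have ea := sig_eq (parr_dom e); have eb := sig_eq (parr_cod e).
by subst a' b'; congr arr; exact: parr_inj.
Qed.

Lemma parr_of_arr Y Z (hZ : Z `<=` Y) (a b a' b' : ob (pi1 d hZ))
    (f : hom (pi1 d hZ) a b) (f' : hom (pi1 d hZ) a' b') :
  arr f = arr f' ->
  parr (f : pihom d Y (proj1_sig a) (proj1_sig b)) =
  parr (f' : pihom d Y (proj1_sig a') (proj1_sig b')).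
Proof.
move=> e; have ea := arr_dom e; have eb := arr_cod e.
by subst a' b'; congr parr; exact: (arr_inj e).
Qed.

(* The units are morphisms between points of [X], because [incl] acts as the
   identity on morphisms when the ambient set [Y] does not change. *)
Definition is_retraction Y Z Z' (hZ : Z `<=` Y) (hZ' : Z' `<=` Y)
    (Q : functor (pi1 d hZ) (pi1 d hZ'))
    (th : forall x : ob (pi1 d hZ),
       pihom d Y (proj1_sig x) (proj1_sig (fobj Q x))) : Prop :=
  [/\ is_functor Q,
      forall (x y : ob (pi1 d hZ)) (f : hom (pi1 d hZ) x y),
        pi_comp f (th y) = pi_comp (th x) (fmap Q f) &
      forall x : ob (pi1 d hZ), Z' (proj1_sig x) ->
        parr (th x) = parr (pi_id d (hZ _ (proj2_sig x)))].

Lemma future_retract_retraction Y Z Z' (hZ : Z `<=` Y) (hZ' : Z' `<=` Y)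
    (hY : Y `<=` Y) (hZZ' : Z' `<=` Z)
    (Q : functor (pi1 d hZ) (pi1 d hZ'))
    (th : forall x, hom (pi1 d hZ) x (fobj (incl d hZ' hZ hY hZZ') (fobj Q x))) :
  is_future_retract (incl d hZ' hZ hY hZZ') Q th -> is_retraction th.
Proof.
move=> [fQ [nat_th [_ unit_th]]]; split=> //.
- move=> x y f.
  have -> : pi_comp f (th y) = pi_comp (th x) (up hY (fmap Q f)) := nat_th x y f.
  by rewrite up_refl.
- move=> x Zx; pose a : ob (pi1 d hZ') := exist _ (proj1_sig x) Zx.
  have ax : fobj (incl d hZ' hZ hY hZZ') a = x by exact: sig_eq.
  have := unit_th a; rewrite ax.
  by move/(congr1 (fun s => arr (projT2 s))) => /= /parr_of_arr.
Qed.

End FundamentalCategory.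

(** * Transport along subdivided dipaths *)

Section Transport.
Variables (R : realType) (X : topologicalType) (d : dspace R X).
Variable Y : bool -> set X.
Hypothesis cover : [set: X] = interior (Y true) `|` interior (Y false).

Definition subdivision (p : R -> X) (n : nat) (t : nat -> R) : Prop :=
  [/\ t 0%N = 0, t n = 1 & forall i, (i < n)%N ->
    [/\ 0 <= t i, t i <= t i.+1, t i.+1 <= 1 &
        exists k, forall s, t i <= s <= t i.+1 -> Y k (p s)]].

Hypothesis subdivide : forall p, dipath d p -> exists n t, subdivision p n t.

Variables (E : precat) (catE : is_category E) (obj : X -> ob E).

(* Adjoining a zero morphism [None] makes the values below total functions of
   arbitrary maps [R -> X]. *)
Definition zhom (x y : X) : Type := option (hom E (obj x) (obj y)).

Definition zid (x : X) : zhom x x := Some (idm (obj x)).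

Definition zcomp (x y z : X) (m : zhom x y) (n : zhom y z) : zhom x z :=
  match m, n with Some f, Some g => Some (comp f g) | _, _ => None end.

Lemma zcomp1l x y (m : zhom x y) : zcomp (zid x) m = m.
Proof. by case: m => //= f; rewrite (proj1 catE). Qed.

Lemma zcomp1r x y (m : zhom x y) : zcomp m (zid y) = m.
Proof. by case: m => //= f; rewrite (proj1 (proj2 catE)). Qed.

Lemma zcompA x y z w (m : zhom x y) (n : zhom y z) (o : zhom z w) :
  zcomp (zcomp m n) o = zcomp m (zcomp n o).
Proof. by case: m n o => [f|] [g|] [h|] //=; rewrite (proj2 (proj2 catE)). Qed.

(** [U k] stands for the given functor on the fundamental category of [Y k], evaluated on paths
    rather than on classes. *)
Variable U : bool -> forall x y : X, (R -> X) -> zhom x y.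
Hypothesis U_dhequiv : forall k x y p q, is_dipath_from d (Y k) x y p ->
  dhequiv d (Y k) x y p q -> U k x y p = U k x y q.
Hypothesis U_cst : forall k x, Y k x -> U k x x (fun _ => x) = zid x.
Hypothesis U_concat : forall k x y z p q, is_dipath_from d (Y k) x y p ->
  is_dipath_from d (Y k) y z q ->
  U k x z (concat p q) = zcomp (U k x y p) (U k y z q).
Hypothesis U_agree : forall k l x y p, is_dipath_from d (Y k) x y p ->
  is_dipath_from d (Y l) x y p -> U k x y p = U l x y p.
Hypothesis U_some : forall k x y p, is_dipath_from d (Y k) x y p ->
  U k x y p <> None.

(** Only [psi t (p t)] matters; the free argument [x] lets the type of the value follow the endpoint
    without transport along equalities of points. *)
Definition lift (a : X) (p : R -> X) (psi : R -> forall x, zhom a x) : Prop :=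
  psi 0 a = zid a /\
  forall k s t, 0 <= s -> s <= t -> t <= 1 ->
    (forall u, s <= u <= t -> Y k (p u)) ->
    psi t (p t) = zcomp (psi s (p s)) (U k (p s) (p t) (restr p s t)).
Arguments lift : clear implicits.

Lemma U_ext k x y p q : is_dipath_from d (Y k) x y p ->
  (forall u, uI u -> q u = p u) -> U k x y p = U k x y q.
Proof. by move=> hp e; apply: U_dhequiv => //; exact: dhequiv_ext. Qed.

Lemma U_split k p s t r : dipath d p -> 0 <= s -> s <= t -> t <= r -> r <= 1 ->
  (forall u, s <= u <= r -> Y k (p u)) ->
  U k (p s) (p r) (restr p s r) =
  zcomp (U k (p s) (p t) (restr p s t)) (U k (p t) (p r) (restr p t r)).
Proof.
move=> dp s0 st tr r1 Yp.
have st1 : t <= 1 by lra.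
rewrite -U_concat; last 2 first.
- by apply: restr_from => // u /andP[? ?]; apply: Yp; apply/andP; split; lra.
- by apply: restr_from => //; [lra|move=> u /andP[? ?]; apply: Yp; apply/andP; split; lra].
apply: U_dhequiv; last exact: restr_split.
by apply: restr_from => //; lra.
Qed.

Lemma U_restr_cst k p s : dipath d p -> uI s -> Y k (p s) ->
  U k (p s) (p s) (restr p s s) = zid (p s).
Proof.
move=> dp s01 Yp; rewrite -(U_cst Yp); symmetry; apply: U_ext.
  exact: const_spec.
by move=> u _; rewrite /restr subrr mulr0 addr0.
Qed.

Lemma cover_point x : exists k, Y k x.
Proof.
have : [set: X] x by [].
by rewrite cover => -[/interior_subset h|/interior_subset h]; [exists true|exists false].
Qed.

Lemma lift_exists a p : dipath d p -> p 0 = a -> exists psi, lift a p psi.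
Proof.
move=> dp p0; destruct p0; have [n [tau [tau0 taun sub]]] := subdivide dp.
suff h i : (i <= n)%N -> exists psi : R -> forall x, zhom (p 0) x,
    psi 0 (p 0) = zid (p 0) /\
    forall k s t, 0 <= s -> s <= t -> t <= tau i ->
    (forall u, s <= u <= t -> Y k (p u)) ->
    psi t (p t) = zcomp (psi s (p s)) (U k (p s) (p t) (restr p s t)).
  by have [psi hpsi] := h n (leqnn n); rewrite taun in hpsi; exists psi.
elim: i => [_|i IH ltin].
  have [k0 Yk0] := cover_point (p 0).
  (* [zid] has no type at a general [x]; the value on the constant path does, and it equals [zid] at
     [x = p 0]. *)
  exists (fun _ x => U k0 (p 0) x (fun _ => p 0)); split; first exact: U_cst.
  move=> k s t s0 st; rewrite tau0 => t0 Yp.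
  have [es et] : s = 0 /\ t = 0 by split; lra.
  subst s t; rewrite U_restr_cst ?zcomp1r //; first exact: uI0.
  by apply: Yp; rewrite lexx.
have [t0 tt t1 [l Yl]] := sub _ ltin.
have [psi hpsi] := IH (ltnW ltin); have psiS := proj2 hpsi.
have {IH} Yl' s t : tau i <= s -> t <= tau i.+1 -> forall u, s <= u <= t -> Y l (p u).
  by move=> ? ? u /andP[? ?]; apply: Yl; apply/andP; split; lra.
(* After [tau i], the old value there is followed by the part of the new piece in [Y l]. A segment
   in [Y k] that straddles [tau i] is split there, and [U_agree] exchanges [U l] for [U k] on its
   right part. *)
exists (fun t x => if t <= tau i then psi t x
  else zcomp (psi (tau i) (p (tau i))) (U l (p (tau i)) x (restr p (tau i) t))).
split; first by rewrite t0 (proj1 hpsi).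
move=> k s t s0 st tti Yp.
have Yp' s' t' : s <= s' -> t' <= t -> forall u, s' <= u <= t' -> Y k (p u).
  by move=> ? ? u /andP[? ?]; apply: Yp; apply/andP; split; lra.
have agree s' t' : s <= s' -> tau i <= s' -> s' <= t' -> t' <= t ->
    U l (p s') (p t') (restr p s' t') = U k (p s') (p t') (restr p s' t').
  move=> *; apply: U_agree; apply: restr_from => //; try lra.
    by apply: Yl' => //; lra.
  exact: Yp'.
case: (leP t (tau i)) => ht.
  by rewrite (le_trans st ht); apply: psiS.
case: (leP s (tau i)) => hs.
  have h1 : t <= 1 by lra.
  rewrite (@U_split k p s (tau i) t) // ?(ltW ht) //.
  rewrite -zcompA -(psiS k s (tau i)) //; last by apply: Yp'; lra.
  by rewrite agree // ?ltW.
have h1 : t <= 1 by lra.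
rewrite (@U_split l p (tau i) s t) // ?(ltW hs) //.
- by rewrite zcompA (agree s t) // ltW.
- by apply: Yl'; lra.
Qed.

(** Both lifts obey the same rule on each piece of a subdivision of [q], so they grow together. The
    case [al = 0], [be = 1] gives uniqueness of values, the cases with [be = 1/2] give
    multiplicativity. *)
Lemma lift_seg (a : X) (r q : R -> X) psi psi' (al be : R) :
  dipath d r -> dipath d q -> lift a r psi -> lift (q 0) q psi' ->
  0 <= al -> 0 <= be -> al + be <= 1 ->
  (forall t, uI t -> r (al + be * t) = q t) ->
  psi (al + be) (q 1) = zcomp (psi al (q 0)) (psi' 1 (q 1)).
Proof.
move=> dr dq [psi0 psiS] [psi'0 psi'S] al0 be0 albe rq.
have [n [tau [tau0 taun sub]]] := subdivide dq.
suff h i : (i <= n)%N -> psi (al + be * tau i) (q (tau i)) =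
    zcomp (psi al (q 0)) (psi' (tau i) (q (tau i))).
  by have := h n (leqnn n); rewrite taun mulr1.
elim: i => [_|i IH ltin]; first by rewrite tau0 mulr0 addr0 psi'0 zcomp1r.
have [t0 tt t1 [k Yk]] := sub _ ltin.
rewrite (psi'S k _ _ t0 tt t1 Yk) -zcompA -(IH (ltnW ltin)).
have t01 : uI (tau i) by rewrite /uI /=; apply/andP; split; lra.
have t01' : uI (tau i.+1) by rewrite /uI /=; apply/andP; split; lra.
have Yr u : al + be * tau i <= u <= al + be * tau i.+1 -> Y k (r u).
  move=> /andP[u0 u1].
  have [b0|b0] := eqVneq be 0.
    have -> : u = al + be * tau i by rewrite b0 in u0 u1 *; lra.
    by rewrite rq //; apply: Yk; rewrite lexx.
  have bp : 0 < be by rewrite lt_neqAle eq_sym b0.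
  have e : be * ((u - al) / be) = u - al by field.
  have v0 : tau i <= (u - al) / be by rewrite -(ler_pM2l bp) e; lra.
  have v1 : (u - al) / be <= tau i.+1 by rewrite -(ler_pM2l bp) e; lra.
  have -> : u = al + be * ((u - al) / be) by rewrite e; lra.
  rewrite rq; first by apply: Yk; rewrite v0.
  by apply/andP; split; [apply: le_trans v0|apply: le_trans v1 _].
have c0 : 0 <= al + be * tau i by nra.
have c1 : al + be * tau i <= al + be * tau i.+1 by nra.
have c2 : al + be * tau i.+1 <= 1 by nra.
have := psiS k _ _ c0 c1 c2 Yr; rewrite !rq // => ->.
congr zcomp; apply: U_ext; first by rewrite -!rq //; exact: restr_from.
move=> u /andP[u0 u1]; rewrite /restr -rq; first by congr r; ring.
by apply/andP; split; nra.
Qed.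

(** As a relation it requires no chosen lift; [val_total] and [val_unique] make it functional on
    dipaths. *)
Definition val (a b : X) (p : R -> X) (m : zhom a b) : Prop :=
  exists2 psi, lift a p psi & p 0 = a /\ m = psi 1 b.

Lemma val_total a b p : is_dipath_from d setT a b p -> exists m, val p (m : zhom a b).
Proof.
move=> [[dp _] [p0 p1]]; have [psi lpsi] := lift_exists dp p0.
by exists (psi 1 b); exists psi.
Qed.

Lemma val_unique a b p q (m n : zhom a b) : is_dipath_from d setT a b p ->
  is_dipath_from d setT a b q -> (forall u, uI u -> p u = q u) ->
  val p m -> val q n -> m = n.
Proof.
move=> [[dp _] [p0 p1]] [[dq _] [q0 q1]] pq [psi lp [_ ->]] [psi' lq [_ ->]].
destruct q0, q1.
have := lift_seg dp dq lp lq (lexx 0) ler01; rewrite add0r (proj1 lp) zcomp1l.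
by apply=> // t t01; rewrite add0r mul1r pq.
Qed.

Lemma val_ext a b p q (m : zhom a b) : is_dipath_from d setT a b p ->
  (forall u, uI u -> q u = p u) -> val p m -> val q m.
Proof.
move=> hp e vp; have hq := is_dipath_from_ext e hp.
have [n vq] := val_total hq.
by rewrite (val_unique hp hq _ vp vq) // => u /e.
Qed.

Lemma val_piece k a b p : is_dipath_from d (Y k) a b p -> val p (U k a b p).
Proof.
move=> hp; have [[dp Yp] [p0 p1]] := hp; destruct p0, p1.
have [psi lp] := lift_exists dp (erefl _); exists psi => //; split=> //.
rewrite (proj2 lp k 0 1) // (proj1 lp) zcomp1l.
by apply: U_ext => // u _; rewrite /restr add0r subr0 mulr1.
Qed.

Lemma val_concat a b c p q (m : zhom a b) (n : zhom b c) :
  is_dipath_from d setT a b p -> is_dipath_from d setT b c q ->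
  val p m -> val q n -> val (concat p q) (zcomp m n).
Proof.
move=> hp hq [psi1 l1 [_ ->]] [psi2 l2 [_ ->]].
have [[dr _] [r0 r1]] := concat_spec hp hq.
have [[dp _] [p0 p1]] := hp; have [[dq _] [q0 q1]] := hq.
have [psi lr] := lift_exists dr r0; exists psi => //; split=> //.
destruct p0, q0, q1.
have h2 : 0 <= 2^-1 :> R by lra.
have := lift_seg dr dq lr l2 h2 h2; have -> : 2^-1 + 2^-1 = 1 :> R by lra.
move=> -> //.
- congr zcomp; move: (lift_seg dr dp lr l1 (lexx 0) h2).
  rewrite add0r (proj1 lr) zcomp1l p1 => -> //.
  + by lra.
  + by move=> t; exact: concat_lo.
- by move=> t t01; apply: concat_hi.
Qed.

Lemma val_some a b p (m : zhom a b) : is_dipath_from d setT a b p ->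
  val p m -> m <> None.
Proof.
move=> [[dp _] [p0 p1]] [psi lp [_ ->]]; destruct p0, p1.
have [n [tau [tau0 taun sub]]] := subdivide dp.
suff h i : (i <= n)%N -> psi (tau i) (p (tau i)) <> None.
  by have := h n (leqnn n); rewrite taun.
elim: i => [_|i IH ltin]; first by rewrite tau0 (proj1 lp).
have [t0 tt t1 [k Yk]] := sub _ ltin.
have := IH (ltnW ltin); rewrite (proj2 lp k _ _ t0 tt t1 Yk).
have := U_some (restr_from dp t0 tt t1 Yk).
by case: (U _ _ _ _) => // f _; case: (psi _ _).
Qed.

(** Pushes a value up one strip of cells. The outermost vertical edges are constant because the
    homotopy fixes endpoints, so they contribute identities. *)
Lemma val_row (H : R -> R -> X) (N : nat) (a b : X) (t0 t1 : R) (m : zhom a b) :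
  dmap2 d H -> 0 <= t0 -> t0 <= t1 -> t1 <= 1 ->
  (forall t, uI t -> H 0 t = a /\ H 1 t = b) ->
  (forall i, (i <= N)%N -> exists k, forall s t,
    i%:R / N.+1%:R <= s <= i.+1%:R / N.+1%:R -> t0 <= t <= t1 -> Y k (H s t)) ->
  val (fun s => H s t0) m -> val (fun s => H s t1) m.
Proof.
move=> dH t00 t01 t11 Hab cell [psi lp [_ ->]].
have ut0 : uI t0 by apply/andP; split; lra.
have ut1 : uI t1 by apply/andP; split; lra.
have drow t : uI t -> dipath d (fun s => H s t).
  by move=> ht; have := proj2 dH _ _ (reparam_id R) (reparam_cst ht).
have dcol s : uI s -> dipath d (H s).
  by move=> hs; have := proj2 dH _ _ (reparam_cst hs) (reparam_id R).
have [psi' lp'] := lift_exists (drow _ ut1) (proj1 (Hab _ ut1)).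
exists psi' => //; split; first exact: (proj1 (Hab _ ut1)).
pose x i : R := i%:R / N.+1%:R.
have Np : 0 < N.+1%:R :> R by rewrite ltr0n.
have x0 : x 0%N = 0 by rewrite /x mul0r.
have x1 : x N.+1 = 1 by rewrite /x divff // gt_eqF.
have x01 i : (i <= N.+1)%N -> uI (x i).
  move=> hi; rewrite /uI /= /x divr_ge0 ?ler0n //=.
  by rewrite ler_pdivrMr // mul1r ler_nat.
have xS i : x i <= x i.+1 by rewrite /x ler_pM2r ?invr_gt0 // ler_nat.
(* The types keep the endpoints [H s t0] and [H s t1], although both equal [c]; they are replaced
   only where the column is used. *)
have col_cst c s k : uI s -> (forall t, uI t -> H s t = c) -> Y k c ->
    U k (H s t0) (H s t1) (restr (H s) t0 t1) = U k (H s t0) (H s t1) (fun _ => c).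
  move=> hs e Yc; apply: U_ext.
    rewrite (e t0) // -(e t1) // {1}(e t1) // -(e t0) //.
    apply: restr_from; [exact: dcol|lra..|].
    by move=> u /andP[? ?]; rewrite e //; apply/andP; split; lra.
  move=> u /andP[? ?]; rewrite /restr e //; apply/andP; split; nra.
(* Invariant: row [t0] up to [x i] and then the column equals row [t1] up to [x i]. It is stated for
   every [k] whose set contains the column, since the cells on its two sides may lie in different
   members of the cover. *)
suff h i : (i <= N.+1)%N -> forall k, (forall t, t0 <= t <= t1 -> Y k (H (x i) t)) ->
    zcomp (psi (x i) (H (x i) t0))
          (U k (H (x i) t0) (H (x i) t1) (restr (H (x i)) t0 t1)) =
    psi' (x i) (H (x i) t1).
  have [k Yk] := cell N (leqnn N).
  have Yk1 t : t0 <= t <= t1 -> Y k (H 1 t).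
    by move=> ht; apply: Yk => //; rewrite -!/(x _) -x1 lexx xS.
  have := h N.+1 (leqnn _) k; rewrite x1 => /(_ Yk1).
  have Yb : Y k b.
    by rewrite -(proj2 (Hab _ ut0)); apply: Yk1; rewrite lexx.
  rewrite (col_cst b) //; [|exact: uI1|by move=> t /Hab []].
  by rewrite !(proj2 (Hab _ _)) // U_cst // zcomp1r.
elim: i => [_|i IH ltin] k Yk.
  rewrite x0 in Yk *.
  have Ya : Y k a.
    by rewrite -(proj1 (Hab _ ut0)); apply: Yk; rewrite lexx.
  rewrite (col_cst a) //; [|exact: uI0|by move=> t /Hab []].
  by rewrite !(proj1 (Hab _ _)) // U_cst // (proj1 lp) (proj1 lp') zcomp1l.
have [l Yl] := cell i ltin.
have {}ltin' : (i <= N.+1)%N := ltnW ltin.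
have /andP[xi0 xi1] := x01 _ ltin'; have /andP[xj0 xj1] := x01 _ ltin.
have xij := xS i.
have Yrow t u : t0 <= t <= t1 -> x i <= u <= x i.+1 -> Y l (H u t).
  by move=> ht hu; apply: Yl.
have Ycol u t : x i <= u <= x i.+1 -> t0 <= t <= t1 -> Y l (H u t).
  by move=> hu ht; apply: Yl.
have ht0 : t0 <= t0 <= t1 by rewrite lexx.
have ht1 : t0 <= t1 <= t1 by rewrite lexx t01.
have hx0 : x i <= x i <= x i.+1 by rewrite lexx.
have hx1 : x i <= x i.+1 <= x i.+1 by rewrite lexx xij.
have left_ := restr_from (dcol _ (x01 _ ltin')) t00 t01 t11 (Ycol _ ^~ hx0).
have right_ := restr_from (dcol _ (x01 _ ltin)) t00 t01 t11 (Ycol _ ^~ hx1).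
have bot := restr_from (drow _ ut0) xi0 xij xj1 (Yrow _ ^~ ht0).
have top := restr_from (drow _ ut1) xi0 xij xj1 (Yrow _ ^~ ht1).
have sq := dhequiv_square dH xi0 xij xj1 t00 t01 t11 Yl.
(* Pass to the index [l] of the cell, exchange bottom-right for left-top, and use the invariant on
   the left column. *)
rewrite (U_agree (restr_from (dcol _ (x01 _ ltin)) t00 t01 t11 Yk) right_).
rewrite (proj2 lp l _ _ xi0 xij xj1 (Yrow _ ^~ ht0)) zcompA -U_concat //.
rewrite (U_dhequiv (concat_spec bot right_) sq) (U_concat left_ top) -zcompA IH //.
  by rewrite (proj2 lp' l _ _ xi0 xij xj1 (Yrow _ ^~ ht1)).
by move=> t ht; apply: Ycol.
Qed.

Lemma val_dihomotopy a b p q (m : zhom a b) :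
  dihomotopy d setT a b p q -> val p m -> val q m.
Proof.
move=> pq vp; have [hp hq] := dihomotopy_from pq.
have [H [cH [H01 [Hab HY]]]] := pq.
have dH : dmap2 d H by split=> // al be ra rb; case: (HY al be ra rb).
have [N grid] := lebesgue_grid cover cH.
have Np : 0 < N.+1%:R :> R by rewrite ltr0n.
pose x i : R := i%:R / N.+1%:R.
have x0 : x 0%N = 0 by rewrite /x mul0r.
have x1 : x N.+1 = 1 by rewrite /x divff // gt_eqF.
have x01 i : (i <= N.+1)%N -> uI (x i).
  move=> hi; rewrite /uI /= /x divr_ge0 ?ler0n //=.
  by rewrite ler_pdivrMr // mul1r ler_nat.
have xS i : x i.+1 = x i + N.+1%:R^-1 by rewrite /x -addn1 natrD mulrDl mul1r.
have xle i : x i <= x i.+1 by rewrite /x ler_pM2r ?invr_gt0 // ler_nat.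
have row t : uI t -> is_dipath_from d setT a b (fun s => H s t).
  move=> ht; have [dt _] := HY _ _ (reparam_id R) (reparam_cst ht).
  by split; [split|exact: Hab].
suff h j : (j <= N.+1)%N -> val (fun s => H s (x j)) m.
  have := h N.+1 (leqnn _); rewrite x1; apply: val_ext; first exact: row (uI1 R).
  by move=> u /H01 [].
elim: j => [_|j IH ltj].
  by rewrite x0; apply: val_ext vp => // u /H01 [].
have /andP[xj0 _] := x01 _ (ltnW ltj); have /andP[_ xj1] := x01 _ ltj.
apply: (val_row dH xj0 (xle j) xj1 Hab _ (IH (ltnW ltj))) => i lti.
have [k Yk] := grid _ _ (x01 i (leqW lti)) (x01 j (ltnW ltj)).
have /andP[xi0 _] := x01 i (leqW lti); have /andP[_ xi1] := x01 i.+1 lti.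
exists k => s t; rewrite -!/(x _) => /andP[s0 s1] /andP[t0 t1].
apply: Yk; rewrite -?xS ?s0 ?t0 //; apply/andP; split.
- exact: le_trans s0.
- exact: le_trans s1 _.
- exact: le_trans t0.
- exact: le_trans t1 _.
Qed.

Lemma val_dhequiv a b p q (m n : zhom a b) : is_dipath_from d setT a b p ->
  dhequiv d setT a b p q -> val p m -> val q n -> m = n.
Proof.
move=> hp pq vp vq; suff vq' : val q m.
  have hq := proj1 (dhequiv_from pq) hp; exact: val_unique vq' vq.
suff : val p m <-> val q m by case=> + _; apply.
elim: pq {hp vp vq} => {p q} [p q pq|p|p q _|p q r _ h1 _ h2] //; last first.
- by rewrite h1.
- by move=> ->.
split; first exact: val_dihomotopy.
(* Dihomotopies carry values forward only. Conversely, some value of [p] is carried to [q] and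
   identified there with the given one by uniqueness. *)
move=> vq; have [hp hq] := dihomotopy_from pq.
have [m' vp] := val_total hp.
by rewrite (val_unique hq hq _ vq (val_dihomotopy pq vp)).
Qed.

End Transport.

(** * Van Kampen for all points *)

(** Exchanges the object map for one that is only pointwise equal to it. The functors on both
    members of the cover are thus rewritten over one object map, and their values lie in the same
    hom-types. *)
Lemma functor_with_obj (C D : precat) (F : functor C D) (o : ob C -> ob D) :
  (forall x, o x = fobj F x) ->
  exists m : forall a b, hom C a b -> hom D (o a) (o b), Functor m = F.
Proof.
case: F => o' m /= e; have eo : o = o' by apply/funext.
by subst o'; exists m.
Qed.

Section VanKampen.
Variables (R : realType) (X : topologicalType) (d : dspace R X).
Variable Y : bool -> set X.
Hypothesis cover : [set: X] = interior (Y true) `|` interior (Y false).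
Hypothesis subdivide : forall p, dipath d p -> exists n t, subdivision Y p n t.
Hypothesis h0 : forall k, Y true `&` Y false `<=` Y k.

Notation Y0 := (Y true `&` Y false).
Notation pX k := (pi1 d (@subset_refl _ (Y k))).
Notation pX0 := (pi1 d (@subset_refl _ Y0)).
Notation pXT := (pi1 d (@subset_refl _ [set: X])).
Notation e k := (incl d (@subset_refl _ Y0) (@subset_refl _ (Y k)) (h0 k) (h0 k)).
Notation eT k := (incl d (@subset_refl _ (Y k)) (@subset_refl _ [set: X])
                     (@subsetT _ _) (@subsetT _ _)).

Lemma van_kampen_exists (E : precat) (u : forall k, functor (pX k) E) :
  is_category E -> (forall k, is_functor (u k)) ->
  fcomp (e true) (u true) = fcomp (e false) (u false) ->
  exists v : functor pXT E, is_functor v /\ forall k, fcomp (eT k) v = u k.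
Proof.
move=> catE fu agree.
have [obj obju] : exists obj : X -> ob E, forall x k (hx : Y k x),
    obj x = fobj (u k) (exist _ x hx).
  suff ex x : exists o, forall k (hx : Y k x), o = fobj (u k) (exist _ x hx).
    by exists (fun x => sval (cid (ex x))) => x; case: (cid (ex x)).
  have agx (h1 : Y true x) (h2 : Y false x) :
      fobj (u true) (exist _ x h1) = fobj (u false) (exist _ x h2).
    have := congr1 (fun F : functor pX0 E => fobj F (exist _ x (conj h1 h2))) agree.
    by rewrite /= (Prop_irrelevance (h0 _ _) h1) (Prop_irrelevance (h0 _ _) h2).
  have [k hk] := cover_point cover x.
  exists (fobj (u k) (exist _ x hk)) => l hl.
  move: k l hk hl => [] [] hk hl.
  - by rewrite (Prop_irrelevance hk hl).
  - exact: agx.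
  - by symmetry; exact: agx.
  - by rewrite (Prop_irrelevance hk hl).
have [M hM] : exists M : forall k (a b : ob (pX k)), hom (pX k) a b ->
      hom E (obj (proj1_sig a)) (obj (proj1_sig b)),
    forall k, Functor (M k) = u k.
  have hu k : exists m : forall a b : ob (pX k), hom (pX k) a b ->
      hom E (obj (proj1_sig a)) (obj (proj1_sig b)), Functor m = u k.
    by apply: functor_with_obj => -[x hx]; exact: obju.
  by exists (fun k => sval (cid (hu k))) => k; case: (cid (hu k)).
have M_id k a : M k a a (idm a) = idm (obj (proj1_sig a)).
  by have [+ _] := fu k; rewrite -hM; apply.
have M_comp k a b c f g : M k a c (comp f g) = comp (M k a b f) (M k b c g).
  by have [_] := fu k; rewrite -hM; apply.
have M_agree (a b : ob pX0) (f : hom pX0 a b) :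
    M true _ _ (fmap (e true) f) = M false _ _ (fmap (e false) f).
  by apply: arr_inj; have := functor_arr f agree; rewrite -!hM.
have dom k x y p : is_dipath_from d (Y k) x y p -> Y k x.
  by move=> [[_ Yp] [<- _]]; apply: Yp; exact: uI0.
have cod k x y p : is_dipath_from d (Y k) x y p -> Y k y.
  by move=> [[_ Yp] [_ <-]]; apply: Yp; exact: uI1.
(* [None] marks paths that are not dipaths of [Y k]. By [UE] the value does not depend on the proofs
   that the endpoints lie in [Y k]. *)
pose U k x y (p : R -> X) : zhom obj x y :=
  match pselect (is_dipath_from d (Y k) x y p) with
  | left h => Some (M k (exist _ x (dom _ _ _ _ h)) (exist _ y (cod _ _ _ _ h)) (cls h))
  | right _ => None
  end.
have UE k x y p (h : is_dipath_from d (Y k) x y p) hx hy :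
    U k x y p = Some (M k (exist _ x hx) (exist _ y hy) (cls h)).
  rewrite /U; case: pselect => // h'.
  by rewrite (Prop_irrelevance h' h) (Prop_irrelevance (dom _ _ _ _ _) hx)
     (Prop_irrelevance (cod _ _ _ _ _) hy).
have U_dhequiv k x y p q : is_dipath_from d (Y k) x y p ->
    dhequiv d (Y k) x y p q -> U k x y p = U k x y q.
  move=> hp pq; have hq := proj1 (dhequiv_from pq) hp.
  rewrite (UE _ _ _ _ hp (dom _ _ _ _ hp) (cod _ _ _ _ hp)).
  rewrite (UE _ _ _ _ hq (dom _ _ _ _ hp) (cod _ _ _ _ hp)).
  by rewrite (cls_eq hp hq pq).
have U_cst k x : Y k x -> U k x x (fun _ => x) = zid obj x.
  move=> hx; rewrite (UE _ _ _ _ (const_spec d hx) hx hx) /zid; congr Some.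
  have ei : cls (const_spec d hx) = idm (exist _ x hx : ob (pX k)) by exact: sig_eq.
  by rewrite ei M_id.
have U_concat k x y z p q : is_dipath_from d (Y k) x y p ->
    is_dipath_from d (Y k) y z q ->
    U k x z (concat p q) = zcomp (U k x y p) (U k y z q).
  move=> hp hq.
  rewrite (UE _ _ _ _ (concat_spec hp hq) (dom _ _ _ _ hp) (cod _ _ _ _ hq)).
  rewrite (UE _ _ _ _ hp (dom _ _ _ _ hp) (cod _ _ _ _ hp)).
  rewrite (UE _ _ _ _ hq (cod _ _ _ _ hp) (cod _ _ _ _ hq)) /zcomp -(pi_comp_cls hp hq).
  congr Some; exact: (M_comp k (exist _ x _) (exist _ y _) (exist _ z _) (cls hp) (cls hq)).
have U_agree k l x y p : is_dipath_from d (Y k) x y p ->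
    is_dipath_from d (Y l) x y p -> U k x y p = U l x y p.
  suff h : is_dipath_from d (Y true) x y p -> is_dipath_from d (Y false) x y p ->
      U true x y p = U false x y p.
    by move: k l => [] [] // h1 h2; rewrite h.
  move=> hp hq.
  have hpq : is_dipath_from d Y0 x y p.
    move: hp hq => [[dp Yp] p01] [[_ Yq] _]; split=> //; split=> // t ht.
    by split; [exact: Yp|exact: Yq].
  have Yx : Y0 x by split; [exact: dom hp|exact: dom hq].
  have Yy : Y0 y by split; [exact: cod hp|exact: cod hq].
  rewrite (UE _ _ _ _ hp (h0 true Yx) (h0 true Yy)).
  rewrite (UE _ _ _ _ hq (h0 false Yx) (h0 false Yy)).
  congr Some; have := M_agree (exist _ x Yx) (exist _ y Yy) (cls hpq).
  rewrite /= -!/(cls _).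
  by rewrite -/(up (@h0 true) (cls hpq)) -/(up (@h0 false) (cls hpq)) !up_cls.
have U_some k x y p : is_dipath_from d (Y k) x y p -> U k x y p <> None.
  by move=> hp; rewrite (UE _ _ _ _ hp (dom _ _ _ _ hp) (cod _ _ _ _ hp)).
pose V := val Y U.
have V_some a b (f : pihom d setT a b) : exists g, V a b (rep f) (Some g).
  have [m vm] := val_total cover subdivide catE U_dhequiv U_cst U_concat U_agree (rep_spec f).
  by have := val_some subdivide U_some (rep_spec f) vm; case: m vm => // g; exists g.
pose G a b f := sval (cid (V_some a b f)).
have VG a b f : V a b (rep f) (Some (G a b f)) by rewrite /G; case: cid.
have V_eq a b p (f : pihom d setT a b) m :
    dhequiv d setT a b (rep f) p -> V a b p m -> Some (G a b f) = m.
  move=> fp vm; exact: (val_dhequiv cover subdivide catE U_dhequiv U_cst U_concat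
    U_agree (rep_spec f) fp (VG _ _ f) vm).
have V_piece k a b p : is_dipath_from d (Y k) a b p -> V a b p (U k a b p).
  exact: (val_piece cover subdivide catE U_dhequiv U_cst U_concat U_agree).
pose v : functor pXT E := @Functor pXT E (fun a => obj (proj1_sig a))
  (fun a b f => G (proj1_sig a) (proj1_sig b) f).
exists v; split; first split.
- move=> a; have [k Yk] := cover_point cover (proj1_sig a).
  suff : Some (G _ _ (idm a)) = zid obj (proj1_sig a) by case.
  apply: (V_eq _ _ (fun _ => proj1_sig a)); first exact: rep_cls.
  by rewrite -(U_cst k) //; apply: V_piece; exact: const_spec.
- move=> a b c f g.
  suff : Some (G _ _ (comp f g)) = zcomp (Some (G _ _ f)) (Some (G _ _ g)) by case.
  apply: (V_eq _ _ (concat (rep f) (rep g))); first exact: rep_cls.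
  by apply: (val_concat cover subdivide catE U_dhequiv U_cst U_concat U_agree);
    [exact: rep_spec..|exact: VG|exact: VG].
- move=> k; rewrite -hM; apply: functor_ext => a b f /=; congr arr.
  suff : Some (G _ _ (up (@subsetT _ (Y k)) f)) = Some (M k a b f) by case.
  apply: (V_eq _ _ (rep f)); first exact: rep_cls.
  have := V_piece _ _ _ _ (rep_spec f).
  case: a b f => [a ha] [b hb] f /=.
  by rewrite (UE _ _ _ _ (rep_spec f) ha hb) cls_rep.
Qed.

End VanKampen.

(** * Retractions *)

Section Retractions.
Variables (R : realType) (X : topologicalType) (d : dspace R X).
Implicit Types Y Z : set X.

(** At points of [Z'] the units are identities, so the naturality square reads [f = Q f]. Bundling
    is needed because [fobj Q x] and [x] are only propositionally the same point. *)
Lemma retraction_id Y Z Z' (hZ : Z `<=` Y) (hZ' : Z' `<=` Y)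
    (Q : functor (pi1 d hZ) (pi1 d hZ'))
    (th : forall x : ob (pi1 d hZ), pihom d Y (proj1_sig x) (proj1_sig (fobj Q x)))
    (x y : ob (pi1 d hZ)) (f : hom (pi1 d hZ) x y) :
  is_retraction th -> Z' (proj1_sig x) -> Z' (proj1_sig y) ->
  parr (fmap Q f : pihom d Y _ _) = parr (f : pihom d Y _ _).
Proof.
move=> [_ nat_th unit_th] Zx Zy.
have ux := unit_th _ Zx; have uy := unit_th _ Zy.
have ux' : parr (pi_id d (hZ' _ (proj2_sig (fobj Q x)))) = parr (th x).
  by rewrite ux; apply: parr_id; exact: parr_cod ux.
have -> : fmap Q f = pi_comp (pi_id d (hZ' _ (proj2_sig (fobj Q x)))) (fmap Q f).
  by rewrite pi_comp1l.
rewrite (parr_comp ux' (erefl _)) -nat_th (parr_comp (erefl _) uy).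
by rewrite pi_comp1r.
Qed.

Lemma retraction_comp Y Z Z' Z'' (hZ : Z `<=` Y) (hZ' : Z' `<=` Y)
    (hZ'' : Z'' `<=` Y) (sub : Z'' `<=` Z')
    (Q : functor (pi1 d hZ) (pi1 d hZ'))
    (th : forall x : ob (pi1 d hZ), pihom d Y (proj1_sig x) (proj1_sig (fobj Q x)))
    (P : functor (pi1 d hZ') (pi1 d hZ''))
    (et : forall x : ob (pi1 d hZ'), pihom d Y (proj1_sig x) (proj1_sig (fobj P x))) :
  is_retraction th -> is_retraction et ->
  is_retraction (Q := fcomp Q P) (fun x => pi_comp (th x) (et (fobj Q x))).
Proof.
move=> [fQ nQ uQ] [fP nP uP]; split; first exact: is_functor_fcomp.
- move=> x y f; rewrite -pi_compA nQ pi_compA.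
  by rewrite (nP _ _ (fmap Q f)) pi_compA.
- move=> x Zx; have ux := uQ x (sub _ Zx).
  have ex := parr_cod ux.
  have ux' : parr (et (fobj Q x)) = parr (pi_id d (hZ _ (proj2_sig x))).
    by rewrite uP ?ex //; apply: parr_id.
  by rewrite (parr_comp ux ux') pi_comp1l.
Qed.

(** Moved into the whole space, the units for the two members of the cover become comparable with
    each other, through the unit on the intersection. *)
Lemma unit_compat Y0 Z0 Y1 Z1 (h0 : Z0 `<=` Y0) (h1 : Z1 `<=` Y1)
    (hY : Y0 `<=` Y1) (hZ : Z0 `<=` Z1) (x y0 : ob (pi1 d h0))
    (f : hom (pi1 d h0) x y0) (y1 : ob (pi1 d h1))
    (g : hom (pi1 d h1) (fobj (incl d h0 h1 hY hZ) x) y1) :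
  existT (fun y => hom (pi1 d h1) (fobj (incl d h0 h1 hY hZ) x) y) _
    (fmap (incl d h0 h1 hY hZ) f) =
  existT (fun y => hom (pi1 d h1) (fobj (incl d h0 h1 hY hZ) x) y) _ g ->
  parr (up (@subsetT _ _) (g : pihom d Y1 _ _)) =
  parr (up (@subsetT _ _) (f : pihom d Y0 _ _)).
Proof.
move/(congr1 (fun s => arr (projT2 s))) => /= /parr_of_arr /(parr_up (@subsetT _ Y1)) <-.
by congr parr; exact: up_up.
Qed.

End Retractions.

(** Uniqueness is phrased as joint epimorphy of [j1] and [j2], so that it also applies to composites
    such as [fcomp v G] that are not given as solutions for a cocone. *)
Definition is_pushout (C0 C1 C2 C3 : precat) (i1 : functor C0 C1)
    (i2 : functor C0 C2) (j1 : functor C1 C3) (j2 : functor C2 C3) : Prop :=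
  fcomp i1 j1 = fcomp i2 j2 /\
  forall E : precat, is_category E ->
    (forall (u1 : functor C1 E) (u2 : functor C2 E),
       is_functor u1 -> is_functor u2 -> fcomp i1 u1 = fcomp i2 u2 ->
       exists v : functor C3 E,
         [/\ is_functor v, fcomp j1 v = u1 & fcomp j2 v = u2]) /\
    (forall v v' : functor C3 E, is_functor v -> is_functor v' ->
       fcomp j1 v = fcomp j1 v' -> fcomp j2 v = fcomp j2 v' -> v = v').

(** * Pushouts of fundamental categories on chosen base points *)

Section Pushout.
Variables (R : realType) (X : topologicalType) (d : dspace R X).
Variable Y : bool -> set X.
Hypothesis cover : [set: X] = interior (Y true) `|` interior (Y false).
Hypothesis subdivide : forall p, dipath d p -> exists n t, subdivision Y p n t.
Hypothesis h0 : forall k, Y true `&` Y false `<=` Y k.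

Variables (Z : bool -> set X) (hZ : forall k, Z k `<=` Y k).
Notation Z0 := (Z true `&` Z false).
Notation ZU := (Z true `|` Z false).
Variables (hZ0 : Z0 `<=` Y true `&` Y false) (z0 : forall k, Z0 `<=` Z k)
  (zU : forall k, Z k `<=` ZU).

Notation pX k := (pi1 d (@subset_refl _ (Y k))).
Notation pX0 := (pi1 d (@subset_refl _ (Y true `&` Y false))).
Notation pZ k := (pi1 d (@hZ k)).
Notation pZ0 := (pi1 d hZ0).
Notation pZU := (pi1 d (@subsetT _ ZU)).
Notation e k := (incl d (@subset_refl _ _) (@subset_refl _ (Y k)) (h0 k) (h0 k)).
Notation i k := (incl d hZ0 (@hZ k) (h0 k) (z0 k)).
Notation j k := (incl d (@hZ k) (@subsetT _ ZU) (@subsetT _ (Y k)) (@zU k)).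

Variables (Q0 : functor pX0 pZ0) (Q : forall k, functor (pX k) (pZ k))
  (th : forall k (x : ob (pX k)), pihom d (Y k) (proj1_sig x) (proj1_sig (fobj (Q k) x))).
Hypothesis Q_retr : forall k, is_retraction (@th k).
Hypothesis Q_compat : forall k, fcomp (e k) (Q k) = fcomp Q0 (i k).
Hypothesis th_compat : forall k l x (hk : Y k x) (hl : Y l x),
  parr (up (@subsetT _ _) (th (exist _ x hk : ob (pX k)))) =
  parr (up (@subsetT _ _) (th (exist _ x hl : ob (pX l)))).

(** The functor obtained on all points is restricted to [ZU]; it extends [w k] because [Q k] fixes
    the morphisms between points of [Z k]. *)
Lemma retract_pushout_exists (E : precat) (w : forall k, functor (pZ k) E) :
  is_category E -> (forall k, is_functor (w k)) ->
  fcomp (i true) (w true) = fcomp (i false) (w false) ->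
  exists v : functor pZU E, is_functor v /\ forall k, fcomp (j k) v = w k.
Proof.
move=> catE fw agree.
have fQ k : is_functor (Q k) by case: (Q_retr k).
have [v [fv hv]] : exists v : functor (pi1 d (@subset_refl _ [set: X])) E,
    is_functor v /\ forall k,
      fcomp (incl d (@subset_refl _ (Y k)) _ (@subsetT _ _) (@subsetT _ _)) v =
      fcomp (Q k) (w k).
  apply: (van_kampen_exists cover subdivide catE (h0 := h0)).
    by move=> k; exact: is_functor_fcomp.
  change (fcomp (fcomp (e true) (Q true)) (w true) =
          fcomp (fcomp (e false) (Q false)) (w false)).
  rewrite !Q_compat.
  change (fcomp Q0 (fcomp (i true) (w true)) = fcomp Q0 (fcomp (i false) (w false))).
  by rewrite agree.
exists (fcomp (incl d (@subsetT _ ZU) (@subset_refl _ [set: X])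
                 (@subsetT _ _) (@subsetT _ _)) v).
split; first by apply: is_functor_fcomp fv; exact: incl_functor.
move=> k; apply: functor_ext => a b f.
pose a' : ob (pX k) := exist _ (proj1_sig a) (hZ (proj2_sig a)).
pose b' : ob (pX k) := exist _ (proj1_sig b) (hZ (proj2_sig b)).
pose f' : hom (pX k) a' b' := f.
have := functor_arr f' (hv k).
have <- : arr (fmap (w k) (fmap (Q k) f')) = arr (fmap (w k) f).
  apply: arr_fmap; apply: arr_of_parr.
  exact: (retraction_id f' (Q_retr k) (proj2_sig a) (proj2_sig b)).
move=> <-; apply: (arr_fmap v); apply: arr_of_parr.
by apply: (congr1 (fun g => parr g)); exact: up_up.
Qed.

Lemma retract_pushout_unique (E : precat) (v v' : functor pZU E) :
  is_functor v -> is_functor v' ->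
  (forall k, fcomp (j k) v = fcomp (j k) v') -> v = v'.
Proof.
move=> [v1 vM] [v1' vM'] vj.
(* The object maps of [v] and [v'] are not yet known to coincide, hence the bundled arrows. *)
pose agree a b (f : hom pZU a b) := arr (fmap v f) = arr (fmap v' f).
have agree_arr a b (f : hom pZU a b) a' b' (f' : hom pZU a' b') :
    arr f = arr f' -> agree _ _ f -> agree _ _ f'.
  by rewrite /agree => ff'; rewrite (arr_fmap v ff') (arr_fmap v' ff').
have agree_comp a b c (f : hom pZU a b) (g : hom pZU b c) :
    agree _ _ f -> agree _ _ g -> agree _ _ (comp f g).
  by rewrite /agree vM vM'; exact: arr_comp.
have agree_j k a b (f : hom (pZ k) a b) : agree _ _ (fmap (j k) f).
  exact: functor_arr f (vj k).
have agree_id a : agree a a (idm a).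
  case: a => x hx; have [k hk] : exists k, Z k x by case: (hx); [exists true|exists false].
  apply: agree_arr (agree_j k _ _ (idm (exist _ x hk : ob (pZ k)))).
  by rewrite (proj1 (incl_functor _ _ _ _ _)); apply: arr_of_parr; exact: parr_id.
(* A point of [ZU] in [Y k] may belong only to the other [Z l]; [th_compat] moves the unit to the
   index at which it is an identity. *)
have th_id k (x : X) (hx : Y k x) : ZU x ->
    parr (up (@subsetT _ _) (th (exist _ x hx : ob (pX k)))) = parr (pi_id d (I : setT x)).
  move=> ZUx; have [l hl] : exists l, Z l x by case: ZUx; [exists true|exists false].
  rewrite (th_compat _ (hZ hl)); case: (Q_retr l) => _ _ /(_ (exist _ x (hZ hl)) hl).
  move/(parr_up (@subsetT _ (Y l))) => ->; congr parr; exact: up_id.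
apply: functor_ext => a b f.
have hp := rep_spec f; set p := rep f in hp; have [[dp _] [p0 p1]] := hp.
have [n [tau [tau0 taun sub]]] := subdivide dp.
(* Naturality of the units turns the product of the pieces of [p] into a
   product of morphisms between points of [Z]. *)
suff h m : (m <= n)%N -> forall x k (hx : Y k x)
    (hm : is_dipath_from d setT (proj1_sig a) x (restr p 0 (tau m))),
    agree a (fobj (j k) (fobj (Q k) (exist _ x hx)))
      (pi_comp (cls hm) (up (@subsetT _ _) (th (exist _ x hx : ob (pX k))))).
  have [k hk] := cover_point cover (proj1_sig b).
  have hn : is_dipath_from d setT (proj1_sig a) (proj1_sig b) (restr p 0 (tau n)).
    by apply: is_dipath_from_ext hp => u _; rewrite /restr taun add0r subr0 mulr1.
  apply: agree_arr (h n (leqnn n) _ k hk hn); apply: arr_of_parr.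
  rewrite (parr_comp (erefl _) (th_id _ _ hk (proj2_sig b))) pi_comp1r.
  congr parr; rewrite -(cls_rep f); apply: cls_eq; apply: dhequiv_ext => // u _.
  by rewrite /restr taun add0r subr0 mulr1.
elim: m => [_|m IH ltmn] x k hx hm.
  have ax : x = proj1_sig a.
    have [_ [_ <-]] := hm; rewrite /restr tau0 subrr mulr0 addr0; exact: p0.
  subst x; apply: agree_arr (agree_id a); apply: arr_of_parr; symmetry.
  rewrite (parr_comp (erefl _) (th_id _ _ hx (proj2_sig a))) pi_comp1r.
  congr parr; apply: cls_eq; apply: dhequiv_ext => // u _.
  by rewrite /restr tau0 subrr mulr0 addr0.
have [t0 tt t1 [l Yl]] := sub _ ltmn.
have ex : x = p (tau m.+1).
  by have [_ [_ <-]] := hm; rewrite /restr add0r mul1r subr0.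
subst x.
have t0' : tau m <= 1 by exact: le_trans t1.
have hl : Y l (p (tau m.+1)) by apply: Yl; rewrite lexx tt.
have hl0 : Y l (p (tau m)) by apply: Yl; rewrite lexx tt.
have piece := restr_from dp t0 tt t1 Yl.
have prev : is_dipath_from d setT (proj1_sig a) (p (tau m)) (restr p 0 (tau m)).
  by rewrite -p0; apply: restr_from.
have step : cls hm = pi_comp (cls prev) (up (@subsetT _ _) (cls piece)).
  rewrite (up_cls (@subsetT _ (Y l)) piece (dipath_from_sub (@subsetT _ (Y l)) piece)).
  rewrite pi_comp_cls; apply: cls_eq.
  by have := @restr_split _ _ d setT p 0 (tau m) (tau m.+1) dp; rewrite p0; apply.
case: (Q_retr l) => _ nat_th _.
have := nat_th (exist _ _ hl0) (exist _ _ hl) (cls piece) => nat_piece.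
(* The path up to [tau m], the piece and the unit at its end compose to the path up to [tau m], the
   unit there and [Q l] of the piece. The first two factors are the induction hypothesis, the last
   one comes from [pZ l]. *)
apply: agree_arr (agree_comp _ _ _ _ _ (IH (ltnW ltmn) _ l hl0 prev)
  (agree_j l _ _ (fmap (Q l) (cls piece : hom (pX l) (exist _ _ hl0) (exist _ _ hl))))).
apply: arr_of_parr; rewrite step.
rewrite (parr_comp (erefl _) (th_compat hx hl)) /= pi_compA -/(up _ _).
by rewrite !pi_compA -!up_comp nat_piece.
Qed.

End Pushout.

Section RetractPushout.
Variables (R : realType) (X : topologicalType) (d : dspace R X).
Variable Y : bool -> set X.
Hypothesis cover : [set: X] = interior (Y true) `|` interior (Y false).
Hypothesis subdivide : forall p, dipath d p -> exists n t, subdivision Y p n t.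
Hypothesis h0 : forall k, Y true `&` Y false `<=` Y k.

Variables (Z : bool -> set X) (hZ : forall k, Z k `<=` Y k).
Notation Z0 := (Z true `&` Z false).
Notation ZU := (Z true `|` Z false).
Variables (hZ0 : Z0 `<=` Y true `&` Y false) (z0 : forall k, Z0 `<=` Z k)
  (zU : forall k, Z k `<=` ZU).
Notation i k := (incl d hZ0 (@hZ k) (h0 k) (z0 k)).
Notation j k := (incl d (@hZ k) (@subsetT _ ZU) (@subsetT _ (Y k)) (@zU k)).

Lemma retract_pushout
    (Q0 : functor (pi1 d (@subset_refl _ (Y true `&` Y false))) (pi1 d hZ0))
    (Q : forall k, functor (pi1 d (@subset_refl _ (Y k))) (pi1 d (@hZ k)))
    (th : forall k (x : ob (pi1 d (@subset_refl _ (Y k)))),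
       pihom d (Y k) (proj1_sig x) (proj1_sig (fobj (Q k) x))) :
  (forall k, is_retraction (@th k)) ->
  (forall k, fcomp (incl d (@subset_refl _ _) (@subset_refl _ (Y k)) (h0 k) (h0 k)) (Q k)
             = fcomp Q0 (i k)) ->
  (forall k l x (hk : Y k x) (hl : Y l x),
    parr (up (@subsetT _ _) (th k (exist _ x hk))) =
    parr (up (@subsetT _ _) (th l (exist _ x hl)))) ->
  is_pushout (i true) (i false) (j true) (j false).
Proof.
move=> Q_retr Q_compat th_compat; split.
  apply: functor_ext => a b f; apply: arr_of_parr; congr parr.
  apply: (etrans (up_up (h0 true) (@subsetT _ _) (@subsetT _ _) f)).
  by symmetry; exact: up_up.
move=> E catE; split.
  move=> u1 u2 fu1 fu2 agree.
  pose w k : functor (pi1 d (@hZ k)) E := if k is true then u1 else u2.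
  have [||v [fv hv]] :=
    retract_pushout_exists cover subdivide zU Q_retr Q_compat (w := w) catE.
  - by case.
  - exact: agree.
  - by exists v; split; [|exact: (hv true)|exact: (hv false)].
move=> v v' fv fv' e1 e2.
by apply: (retract_pushout_unique cover subdivide Q_retr th_compat fv fv'); case.
Qed.

End RetractPushout.

(** * Pushouts in the arrow category *)

Lemma arrow_pushout_of_pushouts (C0 C1 C2 C3 D0 D1 D2 D3 : precat)
  (F0 : functor C0 D0) (F1 : functor C1 D1) (F2 : functor C2 D2)
  (i1 : functor C0 C1) (i2 : functor C0 C2) (j1 : functor C1 C3)
  (j2 : functor C2 C3)
  (i1' : functor D0 D1) (i2' : functor D0 D2) (j1' : functor D1 D3)
  (j2' : functor D2 D3) :
  is_category D3 -> is_functor F1 -> is_functor F2 ->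
  is_functor j1' -> is_functor j2' ->
  fcomp i1 F1 = fcomp F0 i1' -> fcomp i2 F2 = fcomp F0 i2' ->
  is_pushout i1 i2 j1 j2 -> is_pushout i1' i2' j1' j2' ->
  exists P : functor C3 D3,
    [/\ is_functor P, fcomp j1 P = fcomp F1 j1', fcomp j2 P = fcomp F2 j2',
        (forall P' : functor C3 D3, is_functor P' ->
           fcomp j1 P' = fcomp F1 j1' -> fcomp j2 P' = fcomp F2 j2' -> P' = P) &
        arrow_pushout F0 F1 F2 P i1 i2 j1 j2 i1' i2' j1' j2'].
Proof.
move=> catD fF1 fF2 fj1' fj2' e1 e2 [sqC poC] [sqD poD].
(* Precomposing the cocone ([j1'], [j2']) with [F1] and [F2] gives a cocone on the [C] side; [P] is
   the functor that it induces. *)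
have [P [fP P1 P2]] : exists P : functor C3 D3,
    [/\ is_functor P, fcomp j1 P = fcomp F1 j1' & fcomp j2 P = fcomp F2 j2'].
  apply: (proj1 (poC _ catD)); try exact: is_functor_fcomp.
  change (fcomp (fcomp i1 F1) j1' = fcomp (fcomp i2 F2) j2').
  rewrite e1 e2; change (fcomp F0 (fcomp i1' j1') = fcomp F0 (fcomp i2' j2')).
  by rewrite sqD.
exists P; split=> //.
  by move=> P' fP' h1 h2; apply: (proj2 (poC _ catD)); rewrite ?h1 ?h2.
do 6 (split=> //).
move=> E E' G u1 u2 u1' u2' catE catE' fG fu1 fu2 fu1' fu2' g1 g2 a a'.
have [v [fv v1 v2]] := proj1 (poC _ catE) _ _ fu1 fu2 a.
have [v' [fv' v1' v2']] := proj1 (poD _ catE') _ _ fu1' fu2' a'.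
exists (v, v'); split=> /=.
  (* Commutation with [G] is an equality of functors out of [C3], hence it may be tested after [j1]
     and [j2]. *)
  split=> //; apply: (proj2 (poC _ catE')); try exact: is_functor_fcomp.
  - change (fcomp (fcomp j1 v) G = fcomp (fcomp j1 P) v').
    by rewrite v1 P1 g1; change (fcomp F1 u1' = fcomp F1 (fcomp j1' v')); rewrite v1'.
  - change (fcomp (fcomp j2 v) G = fcomp (fcomp j2 P) v').
    by rewrite v2 P2 g2; change (fcomp F2 u2' = fcomp F2 (fcomp j2' v')); rewrite v2'.
move=> [w w'] [/= fw fw' _ [w1 w2] [w1' w2']]; congr pair.
- by apply: (proj2 (poC _ catE)); rewrite ?v1 ?v2 ?w1 ?w2.
- by apply: (proj2 (poD _ catE')); rewrite ?v1' ?v2' ?w1' ?w2'.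
Qed.

(** * The van Kampen setup as a family indexed by booleans *)

Lemma subdivision_of_increasing (R : realType) (X : topologicalType)
    (Y : bool -> set X) (p : R -> X) (n : nat) (t : nat -> R) :
  t 0%N = 0 -> t n = 1 -> (forall i, (i < n)%N -> t i < t i.+1) ->
  (forall i, (i < n)%N -> exists k, forall s, t i <= s <= t i.+1 -> Y k (p s)) ->
  subdivision Y p n t.
Proof.
move=> t0 tn tS Yp; split=> // i ltin.
have mono a b : (a <= b)%N -> (b <= n)%N -> t a <= t b.
  move=> /subnK <-; elim: (b - a)%N => // m IH hm.
  by apply: le_trans (IH (ltnW hm)) _; rewrite addSn; apply: ltW; apply: tS.
split; last exact: Yp.
- by rewrite -t0; apply: mono => //; exact: ltnW.
- exact: ltW (tS _ ltin).
- by rewrite -tn; apply: mono.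
Qed.

(** Indices 1 and 2 become [true] and [false]. The families are defined by matches that compute, so
    at each boolean they return the given data by conversion. *)
Lemma vk_retract_pushout (R : realType) (X : topologicalType) (d : dspace R X)
    (V : vk_data X) (Z1 Z2 : set X) (h1 : Z1 `<=` X1 V) (h2 : Z2 `<=` X2 V)
    (h12 : Z1 `&` Z2 `<=` X0 V)
    (Q0 : functor (cX0 d V) (pi1 d h12)) (Q1 : functor (cX1 d V) (pi1 d h1))
    (Q2 : functor (cX2 d V) (pi1 d h2))
    (t1 : forall x : ob (cX1 d V), pihom d (X1 V) (proj1_sig x) (proj1_sig (fobj Q1 x)))
    (t2 : forall x : ob (cX2 d V), pihom d (X2 V) (proj1_sig x) (proj1_sig (fobj Q2 x))) :
  vk_hyps d V -> is_retraction t1 -> is_retraction t2 ->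
  fcomp (eX1 d V) Q1 = fcomp Q0 (incl d h12 h1 (@subIsetl _ _ _) (@subIsetl _ _ _)) ->
  fcomp (eX2 d V) Q2 = fcomp Q0 (incl d h12 h2 (@subIsetr _ _ _) (@subIsetr _ _ _)) ->
  (forall x (x1 : X1 V x) (x2 : X2 V x),
    parr (up (@subsetT _ _) (t1 (exist _ x x1))) =
    parr (up (@subsetT _ _) (t2 (exist _ x x2)))) ->
  is_pushout (incl d h12 h1 (@subIsetl _ _ _) (@subIsetl _ _ _))
    (incl d h12 h2 (@subIsetr _ _ _) (@subIsetr _ _ _))
    (incl d h1 (@subsetT _ (Z1 `|` Z2)) (@subsetT _ _) (@subsetUl _ _ _))
    (incl d h2 (@subsetT _ (Z1 `|` Z2)) (@subsetT _ _) (@subsetUr _ _ _)).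
Proof.
move=> [cover [subdiv _]] r1 r2 c1 c2 ct.
pose Y (k : bool) := if k then X1 V else X2 V.
pose Z (k : bool) := if k then Z1 else Z2.
have sub p : dipath d p -> exists n t, subdivision Y p n t.
  move=> /subdiv [n [t [t0 [tn [tS hY]]]]]; exists n, t.
  apply: subdivision_of_increasing => // i /hY [h|h]; [by exists true|by exists false].
pose h0 k : Y true `&` Y false `<=` Y k :=
  if k is true then @subIsetl _ _ _ else @subIsetr _ _ _.
pose hZ k : Z k `<=` Y k := if k is true then h1 else h2.
pose z0 k : Z true `&` Z false `<=` Z k :=
  if k is true then @subIsetl _ _ _ else @subIsetr _ _ _.
pose zU k : Z k `<=` Z true `|` Z false :=
  if k is true then @subsetUl _ _ _ else @subsetUr _ _ _.
pose Q k : functor (pi1 d (@subset_refl _ (Y k))) (pi1 d (hZ k)) :=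
  if k is true then Q1 else Q2.
pose th k : forall x : ob (pi1 d (@subset_refl _ (Y k))),
    pihom d (Y k) (proj1_sig x) (proj1_sig (fobj (Q k) x)) :=
  if k is true then t1 else t2.
apply: (@retract_pushout _ _ d Y cover sub h0 Z hZ h12 z0 zU Q0 Q th).
- by case.
- by case.
- move=> [] [] x x1 x2.
  + by rewrite (Prop_irrelevance x1 x2).
  + exact: ct.
  + by symmetry; exact: ct.
  + by rewrite (Prop_irrelevance x1 x2).
Qed.

Theorem theorem4p6 (R : realType) (X : topologicalType) (d : dspace R X)
  (V : vk_data X)
  (Q0 : functor (cX0 d V) (cB0 d V)) (Q1 : functor (cX1 d V) (cB1 d V))
  (Q2 : functor (cX2 d V) (cB2 d V))
  (th0 : forall x, hom (cX0 d V) x (fobj (kB0 d V) (fobj Q0 x)))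
  (th1 : forall x, hom (cX1 d V) x (fobj (kB1 d V) (fobj Q1 x)))
  (th2 : forall x, hom (cX2 d V) x (fobj (kB2 d V) (fobj Q2 x)))
  (P0 : functor (cB0 d V) (cA0 d V)) (P1 : functor (cB1 d V) (cA1 d V))
  (P2 : functor (cB2 d V) (cA2 d V))
  (et0 : forall x, hom (cB0 d V) x (fobj (kA0 d V) (fobj P0 x)))
  (et1 : forall x, hom (cB1 d V) x (fobj (kA1 d V) (fobj P1 x)))
  (et2 : forall x, hom (cB2 d V) x (fobj (kA2 d V) (fobj P2 x))) :
  vk_hyps d V ->
  compatible_Q th0 th1 th2 ->
  compatible_P et0 et1 et2 ->
  exists P : functor (cBX d V) (cAX d V),
    [/\ is_functor P,
        fcomp (j1 d V) P = fcomp P1 (j1' d V),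
        fcomp (j2 d V) P = fcomp P2 (j2' d V),
        (forall P' : functor (cBX d V) (cAX d V), is_functor P' ->
           fcomp (j1 d V) P' = fcomp P1 (j1' d V) ->
           fcomp (j2 d V) P' = fcomp P2 (j2' d V) -> P' = P) &
        arrow_pushout P0 P1 P2 P (i1 d V) (i2 d V) (j1 d V) (j2 d V)
          (i1' d V) (i2' d V) (j1' d V) (j2' d V)].
Proof.
move=> vk [_ [/future_retract_retraction rQ1 [/future_retract_retraction rQ2]]].
move=> [cQ1 [cQ2 [cth1 cth2]]].
move=> [_ [/future_retract_retraction rP1 [/future_retract_retraction rP2]]].
move=> [cP1 [cP2 [cet1 cet2]]].
have cth x (x1 : X1 V x) (x2 : X2 V x) :
    parr (up (@subsetT _ _) (th1 (exist _ x x1) : pihom d _ _ _)) =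
    parr (up (@subsetT _ _) (th2 (exist _ x x2) : pihom d _ _ _)).
  have := unit_compat (cth1 (exist _ x (conj x1 x2))).
  rewrite -(unit_compat (cth2 (exist _ x (conj x1 x2)))) /=.
  by rewrite (Prop_irrelevance (subIsetl _) x1) (Prop_irrelevance (subIsetr _) x2).
(* Stated for two objects over one point, since it is applied at [fobj Q1 x] and [fobj Q2 x]; these
   share their point because the arrows compared by [cth] have equal codomains. *)
have cet (y1 : ob (cB1 d V)) (y2 : ob (cB2 d V)) : proj1_sig y1 = proj1_sig y2 ->
    parr (up (@subsetT _ _) (et1 y1 : pihom d _ _ _)) =
    parr (up (@subsetT _ _) (et2 y2 : pihom d _ _ _)).
  case: y1 y2 => [x x1] [y x2] /= exy; subst y.
  have := unit_compat (cet1 (exist _ x (conj x1 x2))).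
  rewrite -(unit_compat (cet2 (exist _ x (conj x1 x2)))) /=.
  by rewrite (Prop_irrelevance (subIsetl _) x1) (Prop_irrelevance (subIsetr _) x2).
have poB : is_pushout (i1 d V) (i2 d V) (j1 d V) (j2 d V).
  exact: (vk_retract_pushout vk rQ1 rQ2 cQ1 cQ2 cth).
have poA : is_pushout (i1' d V) (i2' d V) (j1' d V) (j2' d V).
  have rA1 := retraction_comp (@hA1B1 _ V) rQ1 rP1.
  have rA2 := retraction_comp (@hA2B2 _ V) rQ2 rP2.
  apply: (vk_retract_pushout (Q0 := fcomp Q0 P0) vk rA1 rA2).
  - change (fcomp (fcomp (eX1 d V) Q1) P1 = fcomp Q0 (fcomp P0 (i1' d V))).
    by rewrite cQ1 -cP1.
  - change (fcomp (fcomp (eX2 d V) Q2) P2 = fcomp Q0 (fcomp P0 (i2' d V))).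
    by rewrite cQ2 -cP2.
  - move=> x x1 x2; rewrite !up_comp; apply: parr_comp; first exact: cth.
    exact: cet (parr_cod (cth x x1 x2)).
apply: arrow_pushout_of_pushouts => //.
- exact: pi1_category.
- by case: rP1.
- by case: rP2.
- exact: incl_functor.
- exact: incl_functor.
Qed.
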